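(* Let $G$ be a compact, torsion-free abelian group. Then $Ext_{tfu}(G,X)=0$ for all groups $X\in\ell$ if and only if $G=0$.
   Context: All groups are Hausdorff topological abelian groups, written additively. $\ell$ is the category of locally compact abelian (LCA) groups with continuous homomorphisms as morphisms. A morphism is proper if it is open onto its image. An extension of $A$ by $C$ in $\ell$ is a short exact sequence $0\to A\stackrel{\phi}{\to}B\stackrel{\psi}{\to}C\to 0$ in $\ell$ in which $\phi$ and $\psi$ are proper morphisms. For a group $G$, $G^{(1)}=\bigcap_{n\ge 1}nG$ is the first Ulm subgroup, and $\overline{S}$ denotes the closure of $S$. Such an extension is a $TFU$ extension if $0\to\overline{A^{(1)}}\stackrel{\overline{\phi}}{\to}\overline{B^{(1)}}\stackrel{\overline{\psi}}{\to}\overline{C^{(1)}}\to 0$ is an extension, where $\overline{\phi}=\phi|_{\overline{A^{(1)}}}$ and $\overline{\psi}=\psi|_{\overline{B^{(1)}}}$. Two extensions $0\to A\stackrel{\phi_1}{\to}B\stackrel{\psi_1}{\to}C\to 0$ and $0\to A\stackrel{\phi_2}{\to}X\stackrel{\psi_2}{\to}C\to 0$ are equivalent if there is a topological isomorphism $\beta:B\to X$ with $\beta\phi_1=\phi_2$ and $\psi_2\beta=\psi_1$. An extension splits if it is equivalent to the trivial extension $0\to A\to A\oplus C\to C\to 0$. $Ext_{tfu}(C,A)$ is the class of all equivalence classes of $TFU$ extensions of $A$ by $C$, and $Ext_{tfu}(C,A)=0$ means that every $TFU$ extension of $A$ by $C$ splits. *)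

(* Defs.v *)
From HB Require Import structures.
From mathcomp Require Import all_boot all_algebra.
From mathcomp Require Import all_classical.
From mathcomp Require Import topology tvs.

Set Implicit Arguments.
Unset Strict Implicit.
Unset Printing Implicit Defensive.

Import GRing.Theory.
Local Open Scope classical_set_scope.
Local Open Scope ring_scope.

(* A topologicalZmodType is a topological abelian group that need not be
   Hausdorff. *)
Definition LCA (G : topologicalZmodType) : Prop :=
  hausdorff_space G /\ locally_compact [set: G].

Definition torsion_free (G : zmodType) : Prop :=
  forall (n : nat) (x : G), (0 < n)%N -> x *+ n = 0 -> x = 0.

#[short(type="contAdditive")]
HB.structure Definition ContinuousAdditive (A B : topologicalZmodType) :=
  {f of @Continuous A B f & @GRing.Additive A B f}.

Definition proper_hom (A B : topologicalZmodType) (f : A -> B) : Prop :=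
  forall U : set A, open U ->
    exists2 V : set B, open V & f @` U = V `&` range f.

Definition short_exact (A B C : topologicalZmodType)
    (phi : contAdditive A B) (psi : contAdditive B C) : Prop :=
  [/\ injective phi, range phi = psi @^-1` [set 0] & range psi = setT].

Definition extension (A B C : topologicalZmodType)
    (phi : contAdditive A B) (psi : contAdditive B C) : Prop :=
  [/\ LCA A, LCA B & LCA C] /\
  [/\ short_exact phi psi, proper_hom phi & proper_hom psi].

Definition ulm1 (G : zmodType) : set G :=
  \bigcap_(n in [set n : nat | (1 <= n)%N]) [set x *+ n | x in [set: G]].
Arguments ulm1 : clear implicits.

Lemma ulm1_0 (G : zmodType) : ulm1 G 0.
Proof. by move=> n _; exists 0; rewrite ?mul0rn. Qed.

Lemma ulm1B (G : zmodType) (x y : G) : ulm1 G x -> ulm1 G y -> ulm1 G (x - y).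
Proof.
move=> ux uy n n0; have [a _ <-] := ux n n0; have [b _ <-] := uy n n0.
by exists (a - b); rewrite ?mulrnBl.
Qed.

Lemma closure_ulm1_0 (G : topologicalZmodType) : closure (ulm1 G) 0.
Proof. by apply: subset_closure; exact: ulm1_0. Qed.

Lemma closure_ulm1B (G : topologicalZmodType) (x y : G) :
  closure (ulm1 G) x -> closure (ulm1 G) y -> closure (ulm1 G) (x - y).
Proof.
move=> cx cy W /(@sub_continuous G (x, y))[[U V] /= [Ux Vy] UVW].
have [a [ua Ua]] := cx _ Ux; have [b [ub Vb]] := cy _ Vy.
by exists (a - b); split; [exact: ulm1B|exact: (UVW (a, b))].
Qed.

(* The closed subgroup of G that is the closure of its first Ulm subgroup,
   with the subspace topology. *)
Definition clUlm (G : topologicalZmodType) : Type :=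
  set_type (closure (ulm1 G)).

Section ClUlm.
Variable G : topologicalZmodType.

Definition clUlm_pred : {pred G} := fun x => x \in closure (ulm1 G).

Lemma clUlm_zmod_closed : zmod_closed clUlm_pred.
Proof.
split=> [|x y]; first by apply/mem_set/closure_ulm1_0.
by move=> /set_mem cx /set_mem cy; apply/mem_set/closure_ulm1B.
Qed.

HB.instance Definition _ := GRing.isZmodClosed.Build G clUlm_pred
  clUlm_zmod_closed.

HB.instance Definition _ := Topological.on (clUlm G).
HB.instance Definition _ : isSub G clUlm_pred (clUlm G) :=
  SubType.on (set_type (closure (ulm1 G))).
HB.instance Definition _ := [SubChoice_isSubZmodule of clUlm G by <:].

Lemma clUlm_val_continuous : continuous (val : clUlm G -> G).
Proof. exact: (@initial_continuous _ _ (set_val : clUlm G -> G)). Qed.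

Lemma continuous_clUlm (T : topologicalType) (f : T -> clUlm G) :
  continuous (val \o f) -> continuous f.
Proof.
move=> /continuousP cf; apply/continuousP => _ [B oB <-].
exact: (cf B oB).
Qed.

Lemma clUlm_sub_continuous :
  continuous (fun x : clUlm G * clUlm G => x.1 - x.2).
Proof.
apply: continuous_clUlm => x.
rewrite (_ : _ \o _ = fun y : clUlm G * clUlm G => val y.1 - val y.2); last first.
  by apply/funext => y; exact: (raddfB (val : clUlm G -> G)).
apply: (@continuous_comp _ _ _
  (fun y : clUlm G * clUlm G => (val y.1, val y.2)) (fun z : G * G => z.1 - z.2)).
  apply: cvg_pair; apply: continuous_comp; try exact: clUlm_val_continuous.
    exact: cvg_fst.
  exact: cvg_snd.
exact: sub_continuous.
Qed.

HB.instance Definition _ :=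
  PreTopologicalNmodule_isTopologicalZmodule.Build (clUlm G) clUlm_sub_continuous.

End ClUlm.

Section ClUlmMap.
Variables (A B : topologicalZmodType) (f : contAdditive A B).

Lemma clUlm_map_subproof (x : clUlm A) : clUlm_pred (f (val x)).
Proof.
apply/mem_set => W /(@cts_fun _ _ f) Wfx.
have [a [ua Wa]] := set_mem (valP x) _ Wfx.
exists (f a); split=> // n n0; have [b _ <-] := ua n n0.
by exists (f b); rewrite ?raddfMn.
Qed.

Definition clUlm_map (x : clUlm A) : clUlm B := Sub _ (clUlm_map_subproof x).

Lemma val_clUlm_map (x : clUlm A) : val (clUlm_map x) = f (val x).
Proof. exact: SubK. Qed.

Lemma clUlm_map_zmod_morphism : zmod_morphism clUlm_map.
Proof. by move=> x y; apply: val_inj; rewrite raddfB !val_clUlm_map !raddfB. Qed.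

Lemma clUlm_map_continuous : continuous clUlm_map.
Proof.
apply: continuous_clUlm => x.
rewrite (_ : _ \o _ = f \o val); last first.
  by apply/funext => y; exact: val_clUlm_map.
by apply: continuous_comp; [exact: clUlm_val_continuous|exact: cts_fun].
Qed.

HB.instance Definition _ :=
  GRing.isZmodMorphism.Build (clUlm A) (clUlm B) clUlm_map clUlm_map_zmod_morphism.
HB.instance Definition _ :=
  @isContinuous.Build (clUlm A) (clUlm B) clUlm_map clUlm_map_continuous.

End ClUlmMap.

Definition tfu_extension (A B C : topologicalZmodType)
    (phi : contAdditive A B) (psi : contAdditive B C) : Prop :=
  extension phi psi /\ extension (clUlm_map phi) (clUlm_map psi).

Definition extension_equiv (A B X C : topologicalZmodType)
    (phi1 : contAdditive A B) (psi1 : contAdditive B C)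
    (phi2 : contAdditive A X) (psi2 : contAdditive X C) : Prop :=
  exists (beta : contAdditive B X) (gamma : contAdditive X B),
    [/\ cancel beta gamma, cancel gamma beta,
        beta \o phi1 =1 phi2 & psi2 \o beta =1 psi1].

(* The library makes the product of two topological groups a topological space
   and a group, but a topologicalZmodType only for topological vector
   spaces. *)
Definition dsum (A C : topologicalZmodType) : Type := (A * C)%type.

Section Dsum.
Variables A C : topologicalZmodType.

HB.instance Definition _ := GRing.Zmodule.on (dsum A C).
HB.instance Definition _ := Topological.on (dsum A C).

Lemma dsum_sub_continuous :
  continuous (fun x : dsum A C * dsum A C => x.1 - x.2).
Proof.
move=> x; apply: cvg_pair => /=.
  apply: (@continuous_comp _ _ _
    (fun y : dsum A C * dsum A C => (y.1.1, y.2.1)) (fun z : A * A => z.1 - z.2)).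
    apply: cvg_pair; apply: continuous_comp; try exact: cvg_fst.
    exact: cvg_snd.
  exact: sub_continuous.
apply: (@continuous_comp _ _ _
  (fun y : dsum A C * dsum A C => (y.1.2, y.2.2)) (fun z : C * C => z.1 - z.2)).
  apply: cvg_pair; apply: continuous_comp; try exact: cvg_snd.
  exact: cvg_fst.
exact: sub_continuous.
Qed.

HB.instance Definition _ :=
  PreTopologicalNmodule_isTopologicalZmodule.Build (dsum A C) dsum_sub_continuous.

Definition dsum_in (a : A) : dsum A C := (a, 0).
Definition dsum_out (x : dsum A C) : C := x.2.

Lemma dsum_in_zmod_morphism : zmod_morphism dsum_in.
Proof. by move=> a b; apply/pair_equal_spec; rewrite /= subr0. Qed.

Lemma dsum_in_continuous : continuous dsum_in.
Proof. by move=> a; apply: cvg_pair; [exact: cvg_id|exact: cvg_cst]. Qed.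

Lemma dsum_out_zmod_morphism : zmod_morphism dsum_out.
Proof. by []. Qed.

Lemma dsum_out_continuous : continuous dsum_out.
Proof. by move=> x; exact: cvg_snd. Qed.

HB.instance Definition _ :=
  GRing.isZmodMorphism.Build A (dsum A C) dsum_in dsum_in_zmod_morphism.
HB.instance Definition _ :=
  @isContinuous.Build A (dsum A C) dsum_in dsum_in_continuous.
HB.instance Definition _ :=
  GRing.isZmodMorphism.Build (dsum A C) C dsum_out dsum_out_zmod_morphism.
HB.instance Definition _ :=
  @isContinuous.Build (dsum A C) C dsum_out dsum_out_continuous.

End Dsum.

Arguments dsum_in : clear implicits.
Arguments dsum_out : clear implicits.

Definition splits (A B C : topologicalZmodType)
    (phi : contAdditive A B) (psi : contAdditive B C) : Prop :=
  extension_equiv phi psi (dsum_in A C) (dsum_out A C).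

(* Ext_tfu(C, A) = 0 *)
Definition Ext_tfu_eq0 (C A : topologicalZmodType) : Prop :=
  forall (B : topologicalZmodType)
         (phi : contAdditive A B) (psi : contAdditive B C),
    tfu_extension phi psi -> splits phi psi.

(* Main.v *)
(* Suppose that every TFU extension by G splits and G <> 0.

   The Haar mean of continuous functions is a limit of averages over finitely
   many translates. Convolution with a nonzero even kernel of mean zero is then
   a nonzero self-adjoint operator T that maps the L^2 unit ball to an
   equicontinuous set, so the supremum L > 0 of |T f|^2 over the unit ball is
   an eigenvalue of T^2. Its eigenspace is translation-invariant, of finite
   dimension by Bessel's inequality, and consists of functions of mean zero. A common eigenvector of the translations
   is a multiple of a nontrivial character chi : G -> R / 2 pi Z.

   Let e : R -> R / 2 pi Z be the quotient map. Give G x R the topology in which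
   (x, r) |-> (x, r, chi x - e r) is an embedding into
   G x R x (R / 2 pi Z with the discrete topology). The projection to G is an
   extension by the discrete group R in which every element over the first Ulm
   subgroup of G lies in the first Ulm subgroup, so it is TFU. The real
   coordinate of a section is a continuous homomorphism G -> R, hence 0, and so
   chi is continuous into the discrete circle: its kernel H is open.

   For H open, let B = H x (G discrete) -> G be the addition map, with kernel
   the discrete group H. As H contains mG for some m > 0, the first Ulm
   subgroups of G and H agree and this extension is TFU. The second coordinate
   of a section is locally constant, hence has finite image, hence vanishes
   because G is torsion-free; so the section takes its values in H and H = G,
   contradicting the nontriviality of chi. *)
Require Import Defs.
From HB Require Import structures.
From mathcomp Require Import all_boot all_order all_algebra.
From mathcomp Require Import all_classical.
From mathcomp Require Import reals topology normedtype tvs trigo.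
From mathcomp Require Import spectral complex Rstruct.
From mathcomp Require Import ring lra.

Set Implicit Arguments.
Unset Strict Implicit.
Unset Printing Implicit Defensive.

Import Order.TTheory GRing.Theory Num.Theory.
Import numFieldNormedType.Exports.
Local Open Scope classical_set_scope.
Local Open Scope ring_scope.

(** * The invariant mean *)

Section TranslationAverage.
Variables (R : realType) (G : zmodType).
Implicit Types (s t : seq G) (f g : G -> R).

(** The empty list gives the zero function, since the inverse of 0 is 0; this is why later bounds
    ask for [0 < size s]. *)
Definition tavg s f : G -> R :=
  fun x => (size s)%:R^-1 * \sum_(a <- s) f (x + a).

(** Commutativity of [G] enters here. Any two averages thereby have a common refinement, on which
    additivity and uniqueness of the mean rest. *)
Lemma tavgC s t f : tavg s (tavg t f) = tavg t (tavg s f).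
Proof.
apply/funext => x; rewrite /tavg.
rewrite -!big_distrr /= mulrCA; congr (_ * (_ * _)).
rewrite exchange_big; apply: eq_bigr => b _; apply: eq_bigr => a _.
by rewrite addrAC.
Qed.

Lemma tavg_comp s t f :
  tavg s (tavg t f) = tavg [seq a + b | a <- s, b <- t] f.
Proof.
apply/funext => x; rewrite /tavg size_allpairs natrM invfM -mulrA.
congr (_ * _); rewrite big_allpairs_dep /= big_distrr /=.
by apply: eq_bigr => a _; congr (_ * _); apply: eq_bigr => b _; rewrite addrA.
Qed.

Lemma tavgD s f g : tavg s (fun x => f x + g x) = fun x => tavg s f x + tavg s g x.
Proof. by apply/funext => x; rewrite /tavg -mulrDr -big_split. Qed.

Lemma tavgZ s c f : tavg s (fun x => c * f x) = fun x => c * tavg s f x.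
Proof. by apply/funext => x; rewrite /tavg -big_distrr /= mulrCA. Qed.

Lemma tavg_shift s f a : tavg s (fun x => f (x + a)) = fun x => tavg s f (x + a).
Proof.
apply/funext => x; rewrite /tavg; congr (_ * _).
by apply: eq_bigr => b _; rewrite addrAC.
Qed.

Lemma tavg_opp s f : tavg [seq - a | a <- s] (fun x => f (- x)) = fun x => tavg s f (- x).
Proof.
apply/funext => x; rewrite /tavg size_map big_map; congr (_ * _).
by apply: eq_bigr => a _; rewrite opprD opprK.
Qed.

Lemma tavg_ge s f c : (0 < size s)%N -> (forall x, c <= f x) ->
  forall x, c <= tavg s f x.
Proof.
move=> s0 cf x; rewrite /tavg mulrC ler_pdivlMr ?ltr0n// mulr_natr.
rewrite -iter_addr_0 -count_predT -big_const_seq.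
exact: ler_sum.
Qed.

Lemma tavg_le s f c : (0 < size s)%N -> (forall x, f x <= c) ->
  forall x, tavg s f x <= c.
Proof.
move=> s0 cf x; rewrite /tavg mulrC ler_pdivrMr ?ltr0n// mulr_natr.
rewrite -iter_addr_0 -count_predT -big_const_seq.
exact: ler_sum.
Qed.

Lemma tavg_dist s f g c : (0 < size s)%N -> (forall x, `|f x - g x| <= c) ->
  forall x, `|tavg s f x - tavg s g x| <= c.
Proof.
move=> s0 fg x; rewrite (_ : _ - _ = tavg s (fun x => f x - g x) x); last first.
  by rewrite /tavg sumrB mulrBr.
rewrite ler_norml; apply/andP; split.
  by apply: tavg_ge => // y; have := fg y; rewrite ler_norml => /andP[].
by apply: tavg_le => // y; have := fg y; rewrite ler_norml => /andP[].
Qed.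

End TranslationAverage.

(** * Uniform continuity and finite covers by translates on a compact group *)

Section UniformContinuity.
Variables (R : realType) (G : topologicalZmodType) (cG : compact [set: G]).
Implicit Types (f : G -> R).

Lemma continuous_addr (a : G) : continuous (fun x : G => x + a).
Proof.
move=> x; apply: (@continuous_comp _ _ _ (fun x : G => (x, a)) (fun z => z.1 + z.2)).
  by apply: cvg_pair; [exact: cvg_id|exact: cvg_cst].
exact: add_continuous.
Qed.

(** The estimate holds near each point (x, 0) by continuity in both variables; compactness in x
    makes the neighbourhood of 0 uniform. *)
Lemma uniformly_continuous f : continuous f -> forall e : R, 0 < e ->
  \forall u \near (0 : G), forall x, `|f (x + u) - f x| < e.
Proof.
move=> cf e e0.
have /compact_near_coveringP/(_ G (nbhs (0 : G)) (fun u x => `|f (x + u) - f x| < e)) := cG.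
suff H : forall x : G, [set: G] x -> \forall x' \near x & u \near (0 : G), `|f (x' + u) - f x'| < e.
  by move=> /(_ _ H); apply: filterS => u Hu x; exact: Hu x I.
move=> x _.
have c1 : {for (x, 0), continuous (fun z : G * G => f (z.1 + z.2) - f z.1)}.
  apply: (@continuousB _ _ _ (fun z : G * G => f (z.1 + z.2)) (fun z => f z.1)).
    apply: (@continuous_comp _ _ _ (fun z : G * G => z.1 + z.2) f).
      exact: add_continuous.
    exact: cf.
  by apply: (@continuous_comp _ _ _ fst f); [exact: cvg_fst|exact: cf].
move: c1 => /cvgrPdist_lt /(_ e e0) /=.
rewrite addr0 subrr; apply: filter_app; near=> z => /=.
by rewrite sub0r normrN.
Unshelve. all: by end_near. Qed.

Lemma translates_cover (U : set G) : nbhs 0 U ->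
  exists t : seq G, (0 < size t)%N /\ forall x, exists2 a, a \in t & U (x + a).
Proof.
move=> U0.
(* The filter of all sufficiently large finite lists. Near-covering compactness along it yields one
   list that serves every point. *)
pose F := filter_from [set: seq G] (fun s => [set t : seq G | {subset s <= t}]).
have FF : Filter F.
  apply: filter_from_filter; first by exists [::].
  move=> s s' _ _; exists (s ++ s') => // t st; split=> a ai; apply: st.
    by rewrite mem_cat ai.
  by rewrite mem_cat ai orbT.
have /compact_near_coveringP/(_ _ F (fun t x => exists2 a, a \in t & U (x + a)) FF) := cG.
(* The extra 0 guarantees that the list is not empty. *)
case=> [x _|s _ /(_ (0 :: s))].
  exists ((fun y => y - x) @^-1` U, [set t : seq G | {subset [:: x; - x] <= t}]) => /=.
    split; last by exists [:: x; - x].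
    by have := @continuous_addr (- x) x U; rewrite /= subrr; exact.
  by move=> [y t] [/= Uy st]; exists (- x) => //; apply: st; rewrite !inE eqxx orbT.
move=> H; exists (0 :: s); split=> // x; apply: H => //.
by move=> a; rewrite inE => ->; rewrite orbT.
Qed.

Lemma continuous_bounded f : continuous f -> exists2 M : R, 0 <= M & forall x, `|f x| <= M.
Proof.
move=> cf; have [t [t0 Ht]] := translates_cover (uniformly_continuous cf ltr01).
(* Every x differs from some [- a] by an element that moves [f] by less than 1, so one summand
   already bounds [f] at x. *)
exists (\sum_(a <- t) (`|f (- a)| + 1)).
  by apply: sumr_ge0 => a _; rewrite addr_ge0.
move=> x; have [a at_ /(_ (- a))] := Ht x.
rewrite addrCA addNr addr0 => /ltW H.
rewrite (big_rem a)//= -[leLHS]addr0; apply: lerD.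
  rewrite -(subrK (f (- a)) (f x)) (le_trans (ler_normD _ _))// addrC lerD2l//.
by apply: sumr_ge0 => b _; rewrite addr_ge0.
Qed.

End UniformContinuity.

(** * Existence, uniqueness and faithfulness of the mean *)

Section InvariantMean.
Variables (R : realType) (G : topologicalZmodType).
Implicit Types (f g : G -> R).

(** The Haar integral of [f] without measure theory: the constant that finite averages of translates
    approach uniformly. *)
Definition is_mean f (c : R) := forall e : R, 0 < e ->
  exists s : seq G, (0 < size s)%N /\ forall x, `|tavg s f x - c| <= e.

Lemma is_mean_between f c lo hi : is_mean f c ->
  (forall x, lo <= f x <= hi) -> lo <= c <= hi.
Proof.
move=> mf lh; apply/andP; split; apply/ler_addgt0Pl => e e0;
  have [s [s0 /(_ 0)]] := mf e e0; rewrite ler_norml => /andP[H1 H2].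
  have : lo <= tavg s f 0 by apply: tavg_ge => // x; case/andP: (lh x).
  lra.
have : tavg s f 0 <= hi by apply: tavg_le => // x; case/andP: (lh x).
lra.
Qed.

Lemma is_mean_shift f c a : is_mean f c -> is_mean (fun x => f (x + a)) c.
Proof.
move=> mf e e0; have [s [s0 Hs]] := mf e e0.
by exists s; split=> // x; rewrite tavg_shift.
Qed.

Lemma is_mean_opp f c : is_mean f c -> is_mean (fun x => f (- x)) c.
Proof.
move=> mf e e0; have [s [s0 Hs]] := mf e e0.
by exists [seq - a | a <- s]; rewrite size_map; split=> // x; rewrite tavg_opp.
Qed.

Lemma is_meanZ f c k : is_mean f c -> is_mean (fun x => k * f x) (k * c).
Proof.
move=> mf e e0; have k0 : 0 < `|k| + 1 by rewrite ltr_wpDl.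
have [s [s0 Hs]] := mf (e / (`|k| + 1)) (divr_gt0 e0 k0).
exists s; split=> // x; rewrite tavgZ -mulrBr normrM.
apply: (@le_trans _ _ (`|k| * (e / (`|k| + 1)))); first by rewrite ler_wpM2l.
rewrite mulrCA ger_pMr// ler_pdivrMr// mul1r; lra.
Qed.

(** Averaging once more does not increase the distance to a constant, so the composite of an average
    good for [f] and one good for [g] is good for both. *)
Lemma is_meanD f g c d : is_mean f c -> is_mean g d ->
  is_mean (fun x => f x + g x) (c + d).
Proof.
move=> mf mg e e0; have e20 : 0 < e / 2 by rewrite divr_gt0.
have [s [s0 Hs]] := mf _ e20; have [t [t0 Ht]] := mg _ e20.
have st (h : G -> R) a r : (0 < size r)%N -> (forall x, `|h x - a| <= e / 2) ->
    forall x, `|tavg r h x - a| <= e / 2.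
  move=> r0 H x; have {}H y : a - e / 2 <= h y <= a + e / 2.
    by have := H y; rewrite ler_distl.
  rewrite ler_distl; apply/andP; split.
    by apply: tavg_ge => // y; case/andP: (H y).
  by apply: tavg_le => // y; case/andP: (H y).
exists [seq a + b | a <- s, b <- t]; rewrite size_allpairs muln_gt0 s0 t0.
split=> // x; rewrite -tavg_comp tavgD tavgD /=.
have H1 := st _ _ _ t0 Hs x; have H2 := st _ _ _ s0 Ht x.
rewrite tavgC opprD addrACA.
rewrite (splitr e) (le_trans (ler_normD _ _))//.
by apply: lerD.
Qed.

Lemma is_mean_cst (c : R) : is_mean (fun=> c) c.
Proof.
move=> e e0; exists [:: 0]; split=> // x.
by rewrite /tavg /= invr1 mul1r big_seq1 subrr normr0 ltW.
Qed.

Lemma is_mean_uniq f c d : is_mean f c -> is_mean f d -> c = d.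
Proof.
move=> mc md; have H := is_meanD mc (is_meanZ (-1) md).
have : (0 <= c + -1 * d <= 0) by apply: (is_mean_between H) => x; apply/andP; split; lra.
by move=> /andP[]; lra.
Qed.

(** The default 0 is a junk value for functions without a mean; on a compact group [meanP] excludes
    it for continuous ones. *)
Definition mean f : R := xget 0 (is_mean f).

Lemma is_meanE f c : is_mean f c -> mean f = c.
Proof. by move=> mf; rewrite /mean; case: xgetP => [d -> md|/(_ c)//]; exact: is_mean_uniq md mf. Qed.

Hypothesis cG : compact [set: G].

Definition squeezed f (w : R) := exists s lo, (0 < size s)%N /\
  forall x, lo <= tavg s f x <= lo + w.

(* Averaging over finitely many translates that reach every point of the group
   contracts the oscillation by a factor depending only on the modulus of
   continuity, which translation averages share. *)
Lemma squeezed_contract f e : continuous f -> 0 < e ->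
  exists2 q : R, 0 < q < 1 & forall w, e <= w -> squeezed f w -> squeezed f (q * w).
Proof.
move=> cf e0; have e40 : 0 < e / 4 by rewrite divr_gt0.
have [t [t0 Ht]] := translates_cover cG (uniformly_continuous cG cf e40).
set k : R := (size t)%:R; have k1 : 1 <= k by rewrite ler1n.
have k0 : 0 < k by apply: lt_le_trans k1.
have ik0 : 0 < k^-1 by rewrite invr_gt0.
have ik1 : k^-1 <= 1 by rewrite invf_le1.
(* Of the [k] translates one will be at most lo + 3w/4 and the others at most lo + w, so their
   average is at most lo + w - w/(4k). *)
exists (1 - k^-1 / 4); first by apply/andP; split; lra.
move=> w ew [s [lo [s0 Hs]]].
have w0 : 0 < w by apply: lt_le_trans ew.
have kw : k^-1 * w <= w by rewrite ger_pMl.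
have kw0 : 0 < k^-1 * w by rewrite mulr_gt0.
(* If the average never enters the lower half of its range, the upper half already is a narrower
   bound. *)
have [[x0 Hx0]|H] := pselect (exists x0, tavg s f x0 <= lo + w / 2); last first.
  exists s, (lo + w / 2); split=> // x; apply/andP; split.
    by rewrite leNgt; apply/negP => Hx; apply: H; exists x; exact: ltW.
  by case/andP: (Hs x) => _ H2; apply: le_trans H2 _; lra.
exists [seq a + b | a <- t, b <- s], lo; rewrite size_allpairs muln_gt0 t0 s0.
split=> // x; rewrite -tavg_comp; apply/andP; split.
  by apply: tavg_ge => // y; case/andP: (Hs y).
have [a at_ Ha] := Ht (x - x0).
have Hxa : tavg s f (x + a) <= lo + w / 2 + w / 4.
  have : `|tavg s (fun y => f (y + (x - x0 + a))) x0 - tavg s f x0| <= e / 4.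
    by apply: tavg_dist => // y; exact/ltW/Ha.
  rewrite tavg_shift /= addrA [x0 + _]addrC subrK ler_norml => /andP[_ ?]; lra.
rewrite /tavg mulrC ler_pdivrMr// (big_rem a)//=.
apply: (@le_trans _ _ (lo + w / 2 + w / 4 + \sum_(y <- rem a t) (lo + w))).
  by apply: lerD => //; apply: ler_sum => b _; case/andP: (Hs (x + b)).
rewrite big_const_seq count_predT iter_addr_0 size_rem//.
rewrite -[X in _ + X]mulr_natr -(subn1 (size t)) natrB// -/k.
have := mulVf (lt0r_neq0 k0) => ek.
have -> : (lo + (1 - k^-1 / 4) * w) * k = lo * k + w * k - (k^-1 * k) * w / 4 by ring.
rewrite ek; lra.
Qed.

(** Take the infimum of the attainable widths that are at least [e]. Some attainable w has q * w
    below this infimum, and q * w is attainable too, so q * w must be below [e]. *)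
Lemma squeezed_small f e : continuous f -> 0 < e -> squeezed f e.
Proof.
move=> cf e0; pose W := [set w | e <= w /\ squeezed f w].
have [M M0 HM] := continuous_bounded cG cf.
have sqM : squeezed f (2 * M).
  exists [:: 0], (- M); split=> // x.
  rewrite /tavg /= invr1 mul1r big_seq1; have := HM (x + 0).
  by rewrite ler_norml => /andP[? ?]; apply/andP; split; lra.
have sqmono w w' : w <= w' -> squeezed f w -> squeezed f w'.
  move=> ww [s [lo [s0 Hs]]]; exists s, lo; split=> // x.
  by case/andP: (Hs x) => -> H /=; lra.
have [q /andP[q0 q1] Hq] := squeezed_contract cf e0.
have hW : has_inf W.
  split; last by exists e => w [].
  exists (Num.max e (2 * M)); split; first by rewrite le_max lexx.
  by apply: sqmono sqM; rewrite le_max lexx orbT.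
have ei : e <= inf W by apply: lb_le_inf => [|w []//]; case: hW.
have [w [ew sw] wi] : exists2 w, W w & w < inf W + (inf W / q - inf W).
  apply: inf_adherent => //; rewrite subr_gt0 ltr_pdivlMr// gtr_pMr//.
  exact: lt_le_trans ei.
rewrite addrC subrK ltr_pdivlMr// in wi.
have [qe|qe] := leP e (q * w).
  have : inf W <= q * w.
    by apply: ge_inf => //; [case: hW|split=> //; exact: Hq].
  by rewrite mulrC leNgt wi.
by apply: sqmono (Hq _ ew sw); exact: ltW.
Qed.

(** A lower bound of one average never exceeds an upper bound of another, by comparison on their
    composite. Hence the supremum of the lower bounds lies in the range of every squeezed
    average. *)
Lemma meanP f : continuous f -> is_mean f (mean f).
Proof.
move=> cf; suff [c mc] : exists c, is_mean f c by rewrite (is_meanE mc).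
pose L := [set lo | exists s, (0 < size s)%N /\ forall x, lo <= tavg s f x].
have LU lo hi : L lo -> (exists s, (0 < size s)%N /\ forall x, tavg s f x <= hi) -> lo <= hi.
  move=> [s [s0 Hs]] [t [t0 Ht]].
  apply: (@le_trans _ _ (tavg t (tavg s f) 0)); first exact: tavg_ge.
  by rewrite tavgC; exact: tavg_le.
have sL : has_sup L.
  have [s [lo [s0 Hs]]] := squeezed_small cf ltr01.
  split; first by exists lo, s; split=> // x; case/andP: (Hs x).
  exists (lo + 1) => l Ll; apply: LU Ll _.
  by exists s; split=> // x; case/andP: (Hs x).
exists (sup L) => e e0; have [s [lo [s0 Hs]]] := squeezed_small cf e0.
exists s; split=> // x; case/andP: (Hs x) => H1 H2.
have l1 : lo <= sup L.
  by apply: sup_upper_bound => //; exists s; split=> // y; case/andP: (Hs y).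
have l2 : sup L <= lo + e.
  apply: sup_le_ub; first by case: sL.
  by move=> l Ll; apply: LU Ll _; exists s; split=> // y; case/andP: (Hs y).
by rewrite ler_norml; apply/andP; split; lra.
Qed.

Lemma meanD f g : continuous f -> continuous g ->
  mean (fun x => f x + g x) = mean f + mean g.
Proof. by move=> cf cg; apply: is_meanE; apply: is_meanD; exact: meanP. Qed.

Lemma meanZ f k : continuous f -> mean (fun x => k * f x) = k * mean f.
Proof. by move=> cf; apply: is_meanE; apply: is_meanZ; exact: meanP. Qed.

Lemma mean_cst (c : R) : mean (fun=> c) = c.
Proof. exact/is_meanE/is_mean_cst. Qed.

Lemma mean_shift f a : continuous f -> mean (fun x => f (x + a)) = mean f.
Proof. by move=> cf; apply/is_meanE/is_mean_shift/meanP. Qed.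

Lemma mean_opp f : continuous f -> mean (fun x => f (- x)) = mean f.
Proof. by move=> cf; apply/is_meanE/is_mean_opp/meanP. Qed.

Lemma mean_between f lo hi : continuous f -> (forall x, lo <= f x <= hi) ->
  lo <= mean f <= hi.
Proof. by move=> /meanP/is_mean_between; exact. Qed.

Lemma mean_ge0 f : continuous f -> (forall x, 0 <= f x) -> 0 <= mean f.
Proof.
move=> cf f0; have [M _ HM] := continuous_bounded cG cf.
have /andP[//] : 0 <= mean f <= M.
by apply: mean_between => // x; rewrite f0/= (le_trans (ler_norm _)).
Qed.

(** If f x0 > 0, every point has a translate from a fixed finite list at which [f] is at least f x0
    / 2. The average over that list is then bounded below by a positive constant, against a mean of
    0. *)
Lemma mean_eq0 f : continuous f -> (forall x, 0 <= f x) -> mean f = 0 ->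
  forall x, f x = 0.
Proof.
move=> cf f0 m0 x0; apply/eqP; rewrite eq_le f0 andbT leNgt; apply/negP => fx0.
have e0 : 0 < f x0 / 2 by rewrite divr_gt0.
have [t [t0 Ht]] := translates_cover cG (uniformly_continuous cG cf e0).
have k0 : 0 < (size t)%:R :> R by rewrite ltr0n.
have H x : f x0 / 2 / (size t)%:R <= tavg t f x.
  have [a at_ Ha] := Ht (x - x0).
  rewrite /tavg [leRHS]mulrC ler_pdivlMr// mulrVK ?unitfE ?lt0r_neq0//.
  rewrite (big_rem a)//= -[leLHS]addr0; apply: lerD; last exact: sumr_ge0.
  have := Ha x0; rewrite addrA [x0 + _]addrC subrK ltr_norml => /andP[? _]; lra.
have e1 : 0 < f x0 / 2 / (size t)%:R / 2 by rewrite !divr_gt0.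
have [s [s0 Hs]] := meanP cf e1.
have H1 : f x0 / 2 / (size t)%:R <= tavg s (tavg t f) 0 by exact: tavg_ge.
have H2 : tavg t (tavg s f) 0 <= f x0 / 2 / (size t)%:R / 2.
  by apply: tavg_le => // x; have := Hs x; rewrite m0 subr0 ler_norml => /andP[].
rewrite tavgC in H1.
move: (le_trans H1 H2); rewrite leNgt => /negP; apply.
by rewrite ltr_pdivrMr// ltr_pMr ?divr_gt0// ltr1n.
Qed.

End InvariantMean.

(** * Fubini's theorem *)

Section Continuity.
Variables (R : realType) (T : topologicalType).

Lemma contD (f g : T -> R) : continuous f -> continuous g -> continuous (fun x => f x + g x).
Proof. by move=> cf cg x; apply: cvgD; [exact: cf|exact: cg]. Qed.

Lemma contM (f g : T -> R) : continuous f -> continuous g -> continuous (fun x => f x * g x).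
Proof. by move=> cf cg x; apply: cvgM; [exact: cf|exact: cg]. Qed.

Lemma contN (f : T -> R) : continuous f -> continuous (fun x => - f x).
Proof. by move=> cf x; apply: cvgN; exact: cf. Qed.

Lemma cont_comp (U V : topologicalType) (h : U -> V) (f : T -> U) :
  continuous h -> continuous f -> continuous (fun x => h (f x)).
Proof. by move=> ch cf x; apply: (@continuous_comp _ _ _ f h); [exact: cf|exact: ch]. Qed.

Lemma cont_cst (U : topologicalType) (a : U) : continuous (fun _ : T => a).
Proof. exact: cst_continuous. Qed.

Lemma cont_pair (U V : topologicalType) (f : T -> U) (g : T -> V) :
  continuous f -> continuous g -> continuous (fun x => (f x, g x)).
Proof. by move=> cf cg x; apply: cvg_pair; [exact: cf|exact: cg]. Qed.

Lemma cont_addG (G : topologicalZmodType) (f g : T -> G) :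
  continuous f -> continuous g -> continuous (fun x => f x + g x).
Proof.
move=> cf cg; apply: (cont_comp (f := fun x => (f x, g x)) (@add_continuous G)).
exact: cont_pair.
Qed.

Lemma cont_oppG (G : topologicalZmodType) (f : T -> G) :
  continuous f -> continuous (fun x => - f x).
Proof. by move=> cf; apply: (cont_comp (@opp_continuous G)). Qed.

Lemma cont_id : continuous (fun x : T => x).
Proof. by move=> x; exact: cvg_id. Qed.

Lemma cont_sum (I : Type) (s : seq I) (f : I -> T -> R) :
  (forall i, continuous (f i)) -> continuous (fun x => \sum_(i <- s) f i x).
Proof.
move=> cf; elim: s => [|i s IH].
  by under eq_fun do rewrite big_nil; exact: cont_cst.
by under eq_fun do rewrite big_cons; apply: contD.
Qed.

End Continuity.

Lemma cont_fst (T U : topologicalType) : continuous (@fst T U).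
Proof. by move=> x; exact: cvg_fst. Qed.

Lemma cont_snd (T U : topologicalType) : continuous (@snd T U).
Proof. by move=> x; exact: cvg_snd. Qed.

Ltac continuity := repeat lazymatch goal with
  | H : continuous ?f |- continuous ?f => exact: H
  | |- continuous (fun x => x) => exact: cont_id
  | |- continuous (fun x => _ * _) => apply: contM
  | |- continuous (fun x => _ + _) => apply: cont_addG
  | |- continuous (fun x => - _) => apply: cont_oppG
  | |- continuous (fun x => (_, _)) => apply: cont_pair
  | |- continuous (fun x => fst x) => exact: cont_fst
  | |- continuous (fun x => snd x) => exact: cont_snd
  | |- continuous (fun x => fst _) => apply: (cont_comp (@cont_fst _ _))
  | |- continuous (fun x => snd _) => apply: (cont_comp (@cont_snd _ _))
  | |- continuous (fun x => \sum_(i <- _) _) => apply: cont_sum => ?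
  | H : continuous ?f |- continuous (fun x => ?f _) => apply: (cont_comp H)
  | |- continuous _ => first
    [ exact: cont_cst | exact: cont_fst | exact: cont_snd | exact: cont_id
    | apply: cont_pair | apply: contM | apply: cont_addG | apply: cont_oppG]
  end.

Section Fubini.
Variables (R : realType) (G : topologicalZmodType) (cG : compact [set: G]).

Lemma continuous_of_uniform (f : G -> R) :
  (forall e : R, 0 < e -> \forall u \near (0 : G), forall x, `|f (x + u) - f x| <= e) ->
  continuous f.
Proof.
move=> H x; apply/cvgrPdist_le => e e0.
have : \forall y \near x, forall z, `|f (z + (y - x)) - f z| <= e.
  by have := @continuous_addr G (- x) x; rewrite /continuous_at subrr => c; exact: (c _ (H e e0)).
by apply: filterS => y /(_ x); rewrite [x + _]addrC subrK distrC.
Qed.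

(** Uniqueness of the Haar integral: [L] has the same value at [f] and at its averages of
    translates, and these are uniformly close to the constant [mean f]. *)
Lemma mean_functional (L : (G -> R) -> R) :
  (forall f g : G -> R, continuous f -> continuous g -> L (fun x => f x + g x) = L f + L g) ->
  (forall (f : G -> R) (k : R), continuous f -> L (fun x => k * f x) = k * L f) ->
  (forall (f : G -> R) (a : G), continuous f -> L (fun x => f (x + a)) = L f) ->
  (forall (f : G -> R) (lo hi : R), continuous f -> (forall x, lo <= f x <= hi) -> lo <= L f <= hi) ->
  forall f : G -> R, continuous f -> L f = mean f.
Proof.
move=> LD LZ LS LB f cf.
have ct s : continuous (tavg s f) by rewrite /tavg; continuity.
have Ltavg s : (0 < size s)%N -> L (tavg s f) = L f.
  move=> s0; rewrite /tavg LZ; last first.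
    by apply: cont_sum => a; apply: (cont_comp cf); continuity.
  have -> : L (fun x => \sum_(a <- s) f (x + a)) = \sum_(a <- s) L f.
    elim: s {s0} => [|a s IH].
      under eq_fun do rewrite big_nil.
      apply/eqP; rewrite big_nil eq_le andbC; apply: LB; first by continuity.
      by move=> x; rewrite lexx.
    under eq_fun do rewrite big_cons.
    rewrite LD ?LS ?IH ?big_cons//; first by continuity.
    by apply: cont_sum => b; continuity.
  rewrite big_const_seq count_predT iter_addr_0 -[L f *+ _]mulr_natl mulrA mulVf ?mul1r//.
  by rewrite pnatr_eq0 -lt0n.
apply/eqP; rewrite eq_le; apply/andP; split; apply/ler_addgt0Pl => e e0;
  have [s [s0 Hs]] := meanP cG cf e0.
  rewrite -(Ltavg s s0); have /LB H := ct s.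
  have /andP[] // : mean f - e <= L (tavg s f) <= e + mean f.
  apply: H => x; have := Hs x; rewrite ler_norml => /andP[? ?]; apply/andP; split; lra.
rewrite -(Ltavg s s0); have /LB H := ct s.
have /andP[+ _] : mean f - e <= L (tavg s f) <= e + mean f.
  apply: H => x; have := Hs x; rewrite ler_norml => /andP[? ?]; apply/andP; split; lra.
by rewrite lerBlDl.
Qed.

End Fubini.

Section Fubini2.
Variables (R : realType) (G : topologicalZmodType) (cG : compact [set: G]).

Lemma compact_dsum : compact [set: dsum G G].
Proof. by have := compact_setX cG cG; rewrite setXTT. Qed.

Implicit Types (F : dsum G G -> R).

Lemma continuous_slice_snd F x : continuous F -> continuous (fun y => F (x, y)).
Proof. by move=> cF; apply: (cont_comp cF); continuity. Qed.

Lemma continuous_slice_fst F y : continuous F -> continuous (fun x => F (x, y)).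
Proof. by move=> cF; apply: (cont_comp cF); continuity. Qed.

Lemma continuous_mean_slice F : continuous F -> continuous (fun x => mean (fun y => F (x, y))).
Proof.
move=> cF; apply: continuous_of_uniform => e e0.
have H := uniformly_continuous compact_dsum cF e0.
have {}H : \forall u \near (0 : G), forall x y, `|F (x + u, y) - F (x, y)| < e.
  have c := @cont_pair G G G id (fun=> 0) (@cont_id _) (@cont_cst _ _ 0) 0.
  have {}H : \forall u \near (0 : G), forall z, `|F (z + (u, 0)) - F z| < e := c _ H.
  apply: filterS H => u Hu x y; have := Hu (x, y).
  by rewrite (_ : (x, y) + (u, 0) = (x + u, y))//; congr pair; exact: addr0.
apply: filterS H => u Hu x.
have -> : mean (fun y => F (x + u, y)) - mean (fun y => F (x, y)) =
    mean (fun y => F (x + u, y) + -1 * F (x, y)).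
  rewrite meanD//; last 2 first.
  - exact: continuous_slice_snd.
  - by apply: contM; [exact: cont_cst|exact: continuous_slice_snd].
  by rewrite meanZ ?mulN1r//; exact: continuous_slice_snd.
rewrite ler_norml; apply: mean_between => //.
  apply: contD; first exact: continuous_slice_snd.
  by apply: contM; [exact: cont_cst|exact: continuous_slice_snd].
by move=> y; rewrite mulN1r -ler_norml; exact: ltW.
Qed.

Lemma cont_swap F : continuous F -> continuous (fun z : dsum G G => F (z.2, z.1)).
Proof.
move=> cF; apply: (cont_comp cF) => z; apply: cvg_pair; [exact: cvg_snd|exact: cvg_fst].
Qed.

(** The iterated mean is linear, invariant and respects bounds, so [mean_functional] on the product
    group identifies it with the mean there. *)
Lemma mean_dsum_fst F : continuous F ->
  mean (fun x => mean (fun y => F (x, y))) = mean F.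
Proof.
have cs := continuous_slice_snd; have cm := continuous_mean_slice.
apply: (@mean_functional R (dsum G G) compact_dsum
  (fun F => mean (fun x => mean (fun y => F (x, y))))).
- move=> f g cf cg; rewrite -meanD; [|done|exact: cm|exact: cm].
  by congr mean; apply/funext => x; rewrite meanD//; exact: cs.
- move=> f k cf; rewrite -meanZ; [|done|exact: cm].
  by congr mean; apply/funext => x; rewrite meanZ//; exact: cs.
- move=> f [a b] cf; rewrite -(mean_shift cG a (cm _ cf)).
  congr mean; apply/funext => x; rewrite -(mean_shift cG b (cs _ (x + a) cf)).
  by [].
- move=> f lo hi cf H; apply: mean_between => //; first exact: cm.
  by move=> x; apply: mean_between => //; exact: cs.
Qed.

Lemma mean_dsum_snd F : continuous F ->
  mean (fun y => mean (fun x => F (x, y))) = mean F.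
Proof.
have cs := continuous_slice_fst.
have cm f (cf : continuous f) := continuous_mean_slice (cont_swap cf).
apply: (@mean_functional R (dsum G G) compact_dsum
  (fun F => mean (fun y => mean (fun x => F (x, y))))).
- move=> f g cf cg; rewrite -meanD; [|done|exact: cm|exact: cm].
  by congr mean; apply/funext => x; rewrite meanD//; exact: cs.
- move=> f k cf; rewrite -meanZ; [|done|exact: cm].
  by congr mean; apply/funext => x; rewrite meanZ//; exact: cs.
- move=> f [a b] cf; rewrite -(mean_shift cG b (cm _ cf)).
  congr mean; apply/funext => x; rewrite -(mean_shift cG a (cs _ (x + b) cf)).
  by [].
- move=> f lo hi cf H; apply: mean_between => //; first exact: cm.
  by move=> x; apply: mean_between => //; exact: cs.
Qed.

Lemma fubini (F : G -> G -> R) : continuous (fun z : G * G => F z.1 z.2) ->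
  mean (fun x => mean (F x)) = mean (fun y => mean (fun x => F x y)).
Proof.
move=> cF; have cF' : continuous (fun z : dsum G G => F z.1 z.2) by [].
by rewrite (mean_dsum_fst cF') (mean_dsum_snd cF').
Qed.

Lemma continuous_mean (F : G -> G -> R) : continuous (fun z : G * G => F z.1 z.2) ->
  continuous (fun x => mean (F x)).
Proof. by move=> cF; apply: (@continuous_mean_slice (fun z => F z.1 z.2)). Qed.

End Fubini2.

(** * Convolution operators and their eigenfunctions *)

Section Convolution.
Variables (R : realType) (G : topologicalZmodType) (cG : compact [set: G]).
Implicit Types (f g h k : G -> R).

Definition ip f g : R := mean (fun x => f x * g x).
Definition conv k f : G -> R := fun x => mean (fun y => k (x - y) * f y).

Lemma ipC f g : ip f g = ip g f.
Proof. by congr mean; apply/funext => x; rewrite mulrC. Qed.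

Lemma ip_ge0 f : continuous f -> 0 <= ip f f.
Proof. by move=> cf; apply: mean_ge0 => //; [continuity|move=> x; rewrite -expr2 sqr_ge0]. Qed.

Lemma ip_eq0 f : continuous f -> ip f f = 0 -> forall x, f x = 0.
Proof.
move=> cf /mean_eq0 H x; apply/eqP; rewrite -sqrf_eq0 expr2; apply/eqP; apply: H => //.
  by continuity.
by move=> y; rewrite -expr2 sqr_ge0.
Qed.

Lemma ipDl f g h : continuous f -> continuous g -> continuous h ->
  ip (fun x => f x + g x) h = ip f h + ip g h.
Proof.
move=> cf cg ch; rewrite /ip -meanD//; [|by continuity..].
by congr mean; apply/funext => x; rewrite mulrDl.
Qed.

Lemma ipZl a f h : continuous f -> continuous h ->
  ip (fun x => a * f x) h = a * ip f h.
Proof.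
move=> cf ch; rewrite /ip -meanZ//; [|by continuity..].
by congr mean; apply/funext => x; rewrite mulrA.
Qed.

Lemma ipDr f g h : continuous f -> continuous g -> continuous h ->
  ip h (fun x => f x + g x) = ip h f + ip h g.
Proof. by move=> cf cg ch; rewrite ipC ipDl// ipC (ipC g). Qed.

Lemma ipZr a f h : continuous f -> continuous h ->
  ip h (fun x => a * f x) = a * ip h f.
Proof. by move=> cf ch; rewrite ipC ipZl// ipC. Qed.

Lemma ip_quad a f g : continuous f -> continuous g ->
  ip (fun x => f x + a * g x) (fun x => f x + a * g x)
    = ip f f + 2 * a * ip f g + a ^+ 2 * ip g g.
Proof.
move=> cf cg; have cag : continuous (fun x => a * g x) by continuity.
have cfg : continuous (fun x => f x + a * g x) by continuity.
by rewrite ipDl// !ipDr// ipZl// !ipZr// ipZl// (ipC g f); ring.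
Qed.

Lemma cauchy_schwarz f g : continuous f -> continuous g ->
  ip f g ^+ 2 <= ip f f * ip g g.
Proof.
move=> cf cg; have := ip_ge0 cg; rewrite le_eqVlt => /predU1P[g0|g0].
  suff -> : ip f g = 0 by rewrite expr0n /= mulr_ge0// ?ip_ge0.
  rewrite /ip -[RHS](mean_cst G 0); congr mean; apply/funext => x.
  by rewrite (ip_eq0 cg (esym g0)) mulr0.
have cfg : continuous (fun x => f x + (- (ip f g / ip g g)) * g x) by continuity.
have := ip_ge0 cfg; rewrite ip_quad// => H.
have {H} := mulr_ge0 (ltW g0) H.
have e : ip g g / ip g g = 1 by rewrite divff// lt0r_neq0.
set a := ip f g; set b := ip g g in e *; set c := ip f f.
have -> : b * (c + 2 * - (a / b) * a + (- (a / b)) ^+ 2 * b) =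
  c * b - 2 * a ^+ 2 * (b / b) + a ^+ 2 * (b / b) ^+ 2 by ring.
by rewrite e; lra.
Qed.

Lemma ip_refl f x : continuous f ->
  ip (fun y => f (x - y)) (fun y => f (x - y)) = ip f f.
Proof.
move=> cf; rewrite /ip (mean_opp cG (f := fun y => f (x + y) * f (x + y))); last by continuity.
rewrite -(mean_shift cG x (f := fun y => f y * f y)); last by continuity.
by congr mean; apply/funext => y; rewrite addrC.
Qed.

Lemma ip_le f e : continuous f -> (forall x, `|f x| <= e) -> ip f f <= e ^+ 2.
Proof.
move=> cf fe; have /andP[] // : 0 <= ip f f <= e ^+ 2.
apply: mean_between => //; first by continuity.
move=> x; rewrite -expr2 sqr_ge0 /= -real_normK ?num_real//.
by rewrite ler_sqr ?nnegrE// (le_trans _ (fe x)).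
Qed.

(** A square-root-free triangle inequality for three error terms; pointwise it is a sum of three
    squares of differences. *)
Lemma ip_sum3_le f g h : continuous f -> continuous g -> continuous h ->
  ip (fun x => f x + g x + h x) (fun x => f x + g x + h x)
    <= 3 * (ip f f + ip g g + ip h h).
Proof.
move=> cf cg ch; have cfg : continuous (fun x => f x + g x) by continuity.
have -> : 3 * (ip f f + ip g g + ip h h) =
    mean (fun x => 3 * (f x * f x + g x * g x + h x * h x)).
  by rewrite meanZ//; [rewrite meanD//; [rewrite meanD//|..]|]; continuity.
rewrite -subr_ge0 -[X in _ - X]mul1r -mulNr -meanZ//; last by continuity.
rewrite -meanD//; [|by continuity..].
apply: mean_ge0 => //; first by continuity.
move=> x; have := sqr_ge0 (f x - g x); have := sqr_ge0 (g x - h x).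
have := sqr_ge0 (f x - h x); rewrite !expr2; lra.
Qed.

(** Cauchy-Schwarz against y |-> k (x - y), whose norm is that of [k]. This turns mean-square bounds
    into uniform ones. *)
Lemma conv_sq_le k f x : continuous k -> continuous f ->
  conv k f x ^+ 2 <= ip k k * ip f f.
Proof.
move=> ck cf; rewrite -(ip_refl x ck); apply: cauchy_schwarz => //; continuity.
Qed.

Lemma continuous_conv k f : continuous k -> continuous f -> continuous (conv k f).
Proof. by move=> ck cf; apply: continuous_mean => //; continuity. Qed.

Lemma convD k f g : continuous k -> continuous f -> continuous g ->
  conv k (fun x => f x + g x) = fun x => conv k f x + conv k g x.
Proof.
move=> ck cf cg; apply/funext => x; rewrite /conv -meanD//; [|by continuity..].
by congr mean; apply/funext => y; rewrite mulrDr.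
Qed.

Lemma convZ k f a : continuous k -> continuous f ->
  conv k (fun x => a * f x) = fun x => a * conv k f x.
Proof.
move=> ck cf; apply/funext => x; rewrite /conv -meanZ//; [|by continuity].
by congr mean; apply/funext => y; rewrite mulrCA.
Qed.

Lemma conv_shift k f a : continuous k -> continuous f ->
  conv k (fun x => f (x + a)) = fun x => conv k f (x + a).
Proof.
move=> ck cf; apply/funext => x; rewrite /conv.
rewrite -(mean_shift cG a (f := fun y => k (x + a - y) * f y)); last by continuity.
congr mean; apply/funext => y; congr (k _ * _).
by rewrite opprD addrACA subrr addr0.
Qed.

(** For a kernel of mean zero this forces eigenfunctions with nonzero eigenvalue to have mean
    zero. *)
Lemma mean_conv k f : continuous k -> continuous f ->
  mean (conv k f) = mean k * mean f.
Proof.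
move=> ck cf; rewrite /conv (fubini cG (F := fun x y => k (x - y) * f y)); last by continuity.
rewrite -meanZ//; congr mean; apply/funext => y.
rewrite -(mean_shift cG (- y) ck) [RHS]mulrC -meanZ//; last by continuity.
by congr mean; apply/funext => x; rewrite mulrC.
Qed.

(** Evenness makes k (x - y) symmetric in x and y; the rest is Fubini. *)
Lemma conv_sym k f g : continuous k -> continuous f -> continuous g ->
  (forall x, k (- x) = k x) -> ip (conv k f) g = ip f (conv k g).
Proof.
move=> ck cf cg ek; rewrite /ip /conv.
transitivity (mean (fun x => mean (fun y => k (x - y) * f y * g x))).
  congr mean; apply/funext => x; rewrite mulrC -meanZ//; last by continuity.
  by congr mean; apply/funext => y; rewrite mulrC.
rewrite (fubini cG (F := fun x y => k (x - y) * f y * g x)); last by continuity.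
congr mean; apply/funext => y; rewrite -meanZ//; last by continuity.
congr mean; apply/funext => x.
by rewrite -ek opprB mulrAC mulrC.
Qed.

(** The difference is the convolution of [f] with k (. + u) - k, so the modulus of continuity of [k]
    serves the whole unit ball. *)
Lemma conv_equicont k f e u : continuous k -> continuous f -> ip f f <= 1 -> 0 <= e ->
  (forall x, `|k (x + u) - k x| <= e) -> forall x, `|conv k f (x + u) - conv k f x| <= e.
Proof.
move=> ck cf f1 e0 ku x; pose k' z := k (z + u) + -1 * k z.
have ck' : continuous k' by rewrite /k'; continuity.
have -> : conv k f (x + u) - conv k f x = conv k' f x.
  rewrite /conv -mulN1r -meanZ//; last by continuity.
  rewrite -meanD//; [|by continuity..].
  by congr mean; apply/funext => y; rewrite /k' addrAC mulrDl mulrA.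
rewrite -ler_sqr ?nnegrE// -normrX ger0_norm ?sqr_ge0//.
apply: (le_trans (conv_sq_le x ck' cf)).
apply: (@le_trans _ _ (ip k' k' * 1)); first by rewrite ler_wpM2l// ip_ge0.
by rewrite mulr1 ip_le// => z; rewrite /k' mulN1r.
Qed.

End Convolution.

Lemma mean_sum (R : realType) (G : topologicalZmodType) (cG : compact [set: G])
    (I : Type) (s : seq I) (F : I -> G -> R) : (forall i, continuous (F i)) ->
  mean (fun x => \sum_(i <- s) F i x) = \sum_(i <- s) mean (F i).
Proof.
move=> cF; elim: s => [|i s IH].
  by rewrite big_nil; under eq_fun do rewrite big_nil; exact: mean_cst.
rewrite big_cons -IH; under eq_fun do rewrite big_cons.
by apply: meanD => //; exact: cont_sum.
Qed.

Lemma ip_sumr (R : realType) (G : topologicalZmodType) (cG : compact [set: G])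
    (n : nat) (a : 'I_n -> R) (f : 'I_n -> G -> R) (h : G -> R) :
  continuous h -> (forall i, continuous (f i)) ->
  ip h (fun x => \sum_i a i * f i x) = \sum_i a i * ip h (f i).
Proof.
move=> ch cf; rewrite /ip.
under eq_fun do rewrite big_distrr /=.
rewrite mean_sum//; last by move=> i; have := cf i => ?; continuity.
apply: eq_bigr => i _; rewrite -meanZ//; last by have := cf i => ?; continuity.
by congr mean; apply/funext => x; rewrite mulrCA.
Qed.

Lemma bessel (R : realType) (G : topologicalZmodType) (cG : compact [set: G])
    (n : nat) (f : 'I_n -> G -> R) (h : G -> R) :
  continuous h -> (forall i, continuous (f i)) ->
  (forall i j, ip (f i) (f j) = (i == j)%:R) ->
  ip (fun x => h x + (-1) * \sum_i ip h (f i) * f i x)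
     (fun x => h x + (-1) * \sum_i ip h (f i) * f i x)
    = ip h h - \sum_i ip h (f i) ^+ 2.
Proof.
move=> ch cf on; pose p x := \sum_i ip h (f i) * f i x.
have cp : continuous p by rewrite /p; apply: cont_sum => i; have := cf i => ?; continuity.
have pf j : ip p (f j) = ip h (f j).
  rewrite ipC ip_sumr// (bigD1 j)//= on eqxx mulr1 big1 ?addr0// => i ij.
  by rewrite on eq_sym (negPf ij) mulr0.
have hp : ip h p = \sum_i ip h (f i) * ip h (f i) by exact: ip_sumr.
have pp : ip p p = \sum_i ip h (f i) * ip h (f i).
  have -> : ip p p = \sum_i ip h (f i) * ip p (f i) by exact: ip_sumr.
  by apply: eq_bigr => i _; rewrite pf.
rewrite [LHS](ip_quad cG (-1) ch cp) pp hp; under [in RHS]eq_bigr do rewrite expr2.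
by ring.
Qed.

(** * The top eigenvalue of the squared convolution operator *)

Section Spectral.
Variables (R : realType) (G : topologicalZmodType) (cG : compact [set: G]).
Variables (k : G -> R).
Hypotheses (ck : continuous k) (ek : forall x, k (- x) = k x).
Implicit Types (f g h : G -> R).

Let T := conv k.

Let Tc f : continuous f -> continuous (T f).
Proof. exact: continuous_conv. Qed.

Definition conv_norms : set R :=
  [set ip (conv k f) (conv k f) | f in [set f | continuous f /\ ip f f <= 1]].
(** The square of the operator norm of convolution by [k] in the mean-square norm. *)
Definition conv_norm := sup conv_norms.

Let ipkk0 : 0 <= ip k k := ip_ge0 cG ck.

Lemma conv_norms_ub f : continuous f -> ip (conv k f) (conv k f) <= ip k k * ip f f.
Proof.
move=> cf; have /andP[] // : 0 <= ip (T f) (T f) <= ip k k * ip f f.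
apply: mean_between => //; first by have := Tc cf; rewrite /T => ?; continuity.
move=> x; rewrite -expr2 sqr_ge0 /=; exact: conv_sq_le.
Qed.

Lemma has_sup_conv_norms : has_sup conv_norms.
Proof.
split.
  exists (ip (conv k (fun=> 0)) (conv k (fun=> 0))), (fun=> 0) => //.
  split; first by continuity.
  by rewrite /ip (_ : (fun _ => _) = fun=> 0) ?mean_cst//; apply/funext => x; rewrite mulr0.
exists (ip k k) => _ [f [cf f1] <-].
by rewrite (le_trans (conv_norms_ub cf))// ler_piMr.
Qed.

Let L := conv_norm.

Lemma conv_norm_ge f : continuous f -> ip (conv k f) (conv k f) <= conv_norm * ip f f.
Proof.
move=> cf; have := ip_ge0 cG cf; rewrite le_eqVlt => /predU1P[f0|f0].
  by rewrite (le_trans (conv_norms_ub cf))// -f0 !mulr0.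
have s0 : 0 < Num.sqrt (ip f f) by rewrite sqrtr_gt0.
pose a := (Num.sqrt (ip f f))^-1.
have a2 : a * a = (ip f f)^-1 by rewrite /a -invfM -expr2 sqr_sqrtr// ltW.
have caf : continuous (fun x => a * f x) by continuity.
have cTf := Tc cf.
rewrite -ler_pdivrMr//; apply: sup_upper_bound; first exact: has_sup_conv_norms.
exists (fun x => a * f x).
  split=> //; rewrite (ipZl cG)// (ipZr cG)// mulrA a2 mulVf//; exact: lt0r_neq0.
by rewrite convZ// (ipZl cG)// ?(ipZr cG)//; [rewrite mulrA a2 mulrC|continuity].
Qed.

(** [k] itself is a test function: since it is even, conv k k at 0 equals ip k k, which is
    positive. *)
Lemma conv_norm_gt0 x0 : k x0 != 0 -> 0 < conv_norm.
Proof.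
move=> k0; have Nk : 0 < ip k k.
  rewrite lt_neqAle ipkk0 andbT eq_sym; apply/eqP => /(ip_eq0 cG ck)/(_ x0)/eqP.
  exact/negP.
have T0 : conv k k 0 != 0.
  rewrite /conv (_ : (fun _ => _) = fun y => k y * k y) ?lt0r_neq0//.
  by apply/funext => y; rewrite sub0r ek.
have NT : 0 < ip (conv k k) (conv k k).
  rewrite lt_neqAle ip_ge0 ?andbT 1?eq_sym//; last exact: Tc.
  by apply/eqP => /(ip_eq0 cG (Tc ck))/(_ 0)/eqP; exact/negP.
by rewrite -(pmulr_lgt0 _ Nk); apply: lt_le_trans NT _; exact: conv_norm_ge.
Qed.

(** Expand the square: the cross term is -2 L |T f|^2 by self-adjointness, and |T (T f)|^2 <= L |T
    f|^2. Near-maximizers are therefore nearly eigenfunctions of T^2. *)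
Lemma almost_maximizer_eigen f : continuous f -> ip f f <= 1 ->
  ip (fun x => T (T f) x + (- L) * f x) (fun x => T (T f) x + (- L) * f x)
  <= L * (L - ip (T f) (T f)).
Proof.
move=> cf f1; have cTf := Tc cf; have cTTf := Tc cTf.
rewrite ip_quad//.
have H1 : ip (T (T f)) (T (T f)) <= L * ip (T f) (T f) by exact: conv_norm_ge.
have H2 : ip (T (T f)) f = ip (T f) (T f) by rewrite /T conv_sym.
have H3 : L ^+ 2 * ip f f <= L ^+ 2 by rewrite ler_piMr// sqr_ge0.
rewrite H2 sqrrN; move: H1 H3; move: (ip _ _) (ip _ _) (ip _ _) => a b c H1 H3.
by rewrite !expr2 in H3 *; move: L H1 H3 => l *; lra.
Qed.

(* Tychonoff gives a pointwise cluster point; equicontinuity of the image of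
   the unit ball makes the approximation uniform. *)
Lemma uniform_maximizer : exists2 g : G -> R, continuous g &
  forall e : R, 0 < e -> exists f, [/\ continuous f, ip f f <= 1,
    conv_norm - e <= ip (conv k f) (conv k f) & forall x, `|conv k f x - g x| <= e].
Proof.
pose A e := [set T f | f in [set f | [/\ continuous f, ip f f <= 1 & L - e <= ip (T f) (T f)]]].
pose F := filter_from [set e : R | 0 < e] A.
have FF : ProperFilter F.
  apply: filter_from_proper; last first.
    move=> e e0; have [_ [f [cf f1] <-] Hf] := sup_adherent e0 has_sup_conv_norms.
    by exists (T f), f => //; split=> //; exact: ltW.
  apply: filter_from_filter; first by exists 1 => /=.
  move=> d e d0 e0; exists (Num.min d e) => /=; first by rewrite lt_min d0.
  move=> _ [f [cf f1 Hf] <-]; split; exists f => //; split=> //; apply: le_trans Hf;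
    by rewrite lerD2l lerN2 ge_min lexx ?orbT.
(* From t <= (t + 1)^2 this bounds |T f| by [conv_sq_le] without a square root. *)
pose C := ip k k + 1.
have bT f x : continuous f -> ip f f <= 1 -> `|T f x| <= C.
  move=> cf f1; have H : T f x ^+ 2 <= ip k k.
    by rewrite (le_trans (conv_sq_le cG x ck cf))// ler_piMr.
  rewrite -ler_sqr ?nnegrE//; last by rewrite /C addr_ge0.
  rewrite real_normK ?num_real// (le_trans H)// /C expr2.
  by have := mulr_ge0 ipkk0 ipkk0; have := ipkk0; lra.
pose B : set {ptws G -> R} := [set g | forall x, [set` `[- C, C]] (g x)].
have cP : compact B.
  by apply: (@tychonoff G (fun=> R) (fun=> [set` `[- C, C]])) => x; exact: segment_compact.
have [g [_ gcl]] : B `&` cluster (F : set_system {ptws G -> R}) !=set0.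
  apply: cP; exists 1 => //= _ [f [cf f1 _] <-] x /=.
  by rewrite in_itv /= -ler_norml; exact: bT.
have pt (s : seq G) e : 0 < e -> exists f, [/\ continuous f, ip f f <= 1,
    L - e <= ip (T f) (T f) & forall a, a \in s -> `|T f a - g a| <= e].
  move=> e0; have : nbhs g [set h : {ptws G -> R} | forall a, a \in s -> `|h a - g a| <= e].
    elim: s => [|b s IH]; first by apply: filterS filterT => h _ a.
    have Hb : \forall h \near g, `|h b - g b| <= e.
      have Ne : nbhs (g b) [set y : R | `|y - g b| <= e].
        have /cvgrPdist_le/(_ e e0) : (fun y : R => y) @ g b --> g b by exact: cvg_id.
        by apply: filterS => y; rewrite distrC.
      exact: (@proj_continuous G (fun=> R) b g _ Ne).
    near=> h => a; rewrite inE => /predU1P[->|]; last by move: a; near: h.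
    by near: h.
  move=> /(gcl (A e)) H; have [_ [[f [cf f1 fe] <-] fs]] := H (ex_intro2 _ _ e e0 (fun _ => id)).
  by exists f.
have unifT e : 0 < e -> \forall u \near (0 : G), forall f x, continuous f -> ip f f <= 1 ->
    `|T f (x + u) - T f x| <= e.
  move=> e0; have := uniformly_continuous cG ck e0; apply: filterS => u ku f x cf f1.
  by apply: conv_equicont => //; [exact: ltW|move=> z; exact: ltW].
have unifg e : 0 < e -> \forall u \near (0 : G), forall x, `|g (x + u) - g x| <= e.
  move=> e0; have e30 : 0 < e / 3 by rewrite divr_gt0.
  apply: filterS (unifT _ e30) => u Hu x.
  have [f [cf f1 _ fe]] := pt [:: x; x + u] _ e30.
  have := fe x; rewrite inE eqxx => /(_ isT).
  have := fe (x + u); rewrite !inE eqxx orbT => /(_ isT).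
  have := Hu f x cf f1; rewrite !ler_norml.
  move=> /andP[? ?] /andP[? ?] /andP[? ?]; apply/andP; split; lra.
exists g; first exact: continuous_of_uniform.
move=> e e0; have e30 : 0 < e / 3 by rewrite divr_gt0.
(* Uniform closeness from finitely many points: one third of [e] each for moving [T f] from x to
   [- a], for replacing [T f] by [g] there, and for moving [g] back. *)
have [t [t0 Ht]] := translates_cover cG (filterI (unifT _ e30) (unifg _ e30)).
have [f [cf f1 fL fe]] := pt [seq - a | a <- t] _ e30.
exists f; split=> //; first by apply: le_trans fL; rewrite lerD2l lerN2; lra.
move=> x; have [a at_ [Ha1 Ha2]] := Ht x.
have := fe (- a) (map_f _ at_).
have := Ha1 f (- a) cf f1; have := Ha2 (- a).
rewrite [- a + _]addrCA addNr addr0 !ler_norml.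
move=> /andP[? ?] /andP[? ?] /andP[? ?]; apply/andP; split; rewrite -/T; lra.
Unshelve. all: by end_near. Qed.

(** [g] is a uniform limit of images T f of near-maximizers. It is nonzero because |T f|^2 stays
    near L, and T^2 g = L g because T^2 f - L f becomes small. *)
Lemma eigenfunction x0 : k x0 != 0 -> exists g : G -> R,
  [/\ continuous g, exists x, g x != 0 &
      forall x, conv k (conv k g) x = conv_norm * g x].
Proof.
move=> kx0; have L0 : 0 < L := conv_norm_gt0 kx0.
have L0' := ltW L0.
have [g cg Hg] := uniform_maximizer.
have cTg := Tc cg; have cTTg := Tc cTg.
exists g; split=> //.
  apply: contrapT => H; have g0 x : g x = 0.
    by apply/eqP; apply: contrapT => /negP gx; apply: H; exists x.
  (* If g = 0, then |T f|^2 <= e^2 <= L / 4, whereas near-maximality gives |T f|^2 >= 3 L / 4. *)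
  pose e : R := Num.min 1 (L / 4).
  have e0 : 0 < e by rewrite lt_min ltr01 divr_gt0.
  have e1 : e <= 1 by rewrite ge_min lexx.
  have eL : e <= L / 4 by rewrite ge_min lexx orbT.
  have [f [cf f1 fL fe]] := Hg e e0.
  have /(ip_le cG (Tc cf)) : forall x, `|conv k f x| <= e.
    by move=> x; have := fe x; rewrite g0 subr0.
  have : e ^+ 2 <= e by rewrite expr2 ger_pMl.
  rewrite -/L -/T in fL *; lra.
pose D x := T (T g) x + (- L) * g x.
have cD : continuous D by rewrite /D; continuity.
suff ND : ip D D = 0.
  by move=> x; have := ip_eq0 cG cD ND x; rewrite /D -/T -/L mulNr; lra.
have small e : 0 < e -> e <= 1 -> ip D D <= (9 * L ^+ 2) * e.
  move=> e0 e1; have [f [cf f1 fL fe]] := Hg e e0.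
  have cTf := Tc cf; have cTTf := Tc cTf; have cTTTf := Tc cTTf.
  pose d x := g x + (-1) * T f x.
  have cd : continuous d by rewrite /d; continuity.
  have cTd := Tc cd; have cTTd := Tc cTd.
  pose q x := T (T f) x + (- L) * f x.
  have cq : continuous q by rewrite /q; continuity.
  have cTq := Tc cq.
  (* With d = g - T f and q = T^2 f - L f, the terms in T^3 f and L T f cancel. Each of the three
     remaining terms has squared norm at most L^2 e, and [ip_sum3_le] gives the factor 9. *)
  have De : D = fun x => T (T d) x + (- L) * d x + T q x.
    apply/funext => x; rewrite /D.
    have -> : T q = fun x => T (T (T f)) x + (- L) * T f x.
      by rewrite /T /q convD// ?convZ//; continuity.
    have -> : T (T d) = fun x => T (T g) x + (-1) * T (T (T f)) x.
      rewrite /T /d convD// ?convZ//; last by continuity.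
      by rewrite convD// ?convZ//; continuity.
    by rewrite /d; ring.
  have Nd : ip d d <= e ^+ 2.
    by apply: ip_le => // x; rewrite /d mulN1r distrC; exact: fe.
  have Nd' : ip d d <= e by rewrite (le_trans Nd)// expr2 ger_pMl.
  have NTd : ip (T d) (T d) <= L * e.
    by rewrite (le_trans (conv_norm_ge cd))// ler_wpM2l.
  have NTTd : ip (T (T d)) (T (T d)) <= L * (L * e).
    by rewrite (le_trans (conv_norm_ge cTd))// ler_wpM2l.
  have NLd : ip (fun x => (- L) * d x) (fun x => (- L) * d x) <= L * (L * e).
    rewrite (ipZl cG)// ?(ipZr cG)//; last by continuity.
    by rewrite mulrA mulrNN -mulrA; do 2!apply: ler_wpM2l => //.
  have NTq : ip (T q) (T q) <= L * (L * e).
    rewrite (le_trans (conv_norm_ge cq))// ler_wpM2l//.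
    rewrite (le_trans (almost_maximizer_eigen cf f1))// ler_wpM2l//.
    by rewrite lerBlDr -lerBlDl.
  rewrite De.
  have cLd : continuous (fun x => (- L) * d x) by continuity.
  apply: (le_trans (ip_sum3_le cG cTTd cLd cTq)); rewrite expr2; lra.
apply/eqP; rewrite eq_le ip_ge0// andbT.
have L2 : 0 < 9 * L ^+ 2 by rewrite mulr_gt0// exprn_gt0.
apply/ler_addgt0Pl => e e0; rewrite addr0.
apply: (le_trans (small (Num.min 1 (e / (9 * L ^+ 2))) _ _)).
- by rewrite lt_min ltr01 divr_gt0.
- by rewrite ge_min lexx.
- by rewrite mulrC -ler_pdivlMr// ge_min lexx orbT.
Qed.

(* Bessel's inequality for k (x - .) against an orthonormal family of
   eigenfunctions, integrated over x. *)
Lemma orthonormal_eigen_bound (n : nat) (f : 'I_n -> G -> R) :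
  (forall i, continuous (f i)) ->
  (forall i x, conv k (conv k (f i)) x = conv_norm * f i x) ->
  (forall i j, ip (f i) (f j) = (i == j)%:R) ->
  n%:R * conv_norm <= ip k k.
Proof.
move=> cf ef on; have cTf i := Tc (cf i).
have H x : \sum_i T (f i) x * T (f i) x <= ip k k.
  pose h y := k (x - y); have ch : continuous h by rewrite /h; continuity.
  rewrite -(ip_refl cG x ck) -subr_ge0.
  under eq_bigr do rewrite -expr2.
  rewrite -(bessel cG ch cf on) ip_ge0//.
  apply: contD => //; apply: contM; first by continuity.
  by apply: cont_sum => i; have := cf i => ?; continuity.
have -> : n%:R * conv_norm = mean (fun x => \sum_i T (f i) x * T (f i) x).
  rewrite mean_sum//; last by move=> i; have := cTf i => ?; continuity.
  rewrite (eq_bigr (fun=> conv_norm)) => [|i _].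
    by rewrite sumr_const card_ord mulr_natl.
  rewrite -/(ip _ _) /T conv_sym//.
  rewrite (_ : conv k _ = fun x => conv_norm * f i x); last exact/funext/ef.
  by rewrite (ipZr cG)// on eqxx mulr1.
have cS : continuous (fun x => \sum_i T (f i) x * T (f i) x).
  by apply: cont_sum => i; have := cTf i => ?; continuity.
have /andP[] // : 0 <= mean (fun x => \sum_i T (f i) x * T (f i) x) <= ip k k.
apply: mean_between => // x; rewrite H andbT; apply: sumr_ge0 => i _.
by rewrite -expr2 sqr_ge0.
Qed.

End Spectral.

(** * Characters *)

(** Append members outside the current span; each raises the dimension, which is bounded. This
    reduces an infinite commuting family of matrices to a finite list. *)
Lemma finite_span (K : fieldType) (V : vectType K) (X : Type) (A : X -> V) :
  exists s : seq X, forall x, A x \in <<map A s>>%VS.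
Proof.
suff H k : (exists s : seq X, forall x, A x \in <<map A s>>%VS) \/
    (exists s : seq X, (k <= \dim <<map A s>>)%N).
  have [//|[s]] := H (\dim {: V}).+1.
  by rewrite ltnNge dimvS ?subvf.
elim: k => [|k [|[s ks]]]; [by right; exists [::]|by left|].
have [H|] := pselect (forall x, A x \in <<map A s>>%VS); first by left; exists s.
move=> /existsNP[x /negP xs]; right; exists (x :: s).
rewrite map_cons span_cons (leq_ltn_trans ks)//.
have sub : (<<map A s>> <= <[A x]> + <<map A s>>)%VS by exact: addvSr.
rewrite ltn_neqAle dimvS// andbT; apply/eqP => e.
have /eqP E : (<<map A s>> == <[A x]> + <<map A s>>)%VS by rewrite eqEdim sub e leqnn.
by move/negP: xs; apply; rewrite E memvE addvSl.
Qed.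

(** A common eigenvector of a finite spanning subfamily is an eigenvector of every linear
    combination, hence of the whole family. *)
Lemma common_eigenvector_family (C : numClosedFieldType) (n : nat) (X : Type)
    (A : X -> 'M[C]_n) : (0 < n)%N -> (forall x y, A x *m A y = A y *m A x) ->
  exists2 v : 'rV[C]_n, v != 0 & forall x, exists a, v *m A x = a *: v.
Proof.
move=> n0 AC; have [s Hs] := finite_span A.
have [|v v0 /allP vs] := common_eigenvector (As := map A s) n0.
  have mem M : M \in map A s -> exists x, M = A x.
    elim: s {Hs} => [|x s IH]; first by rewrite in_nil.
    by rewrite inE => /predU1P[->|/IH//]; exists x.
  by move=> M N /mem[x ->] /mem[y ->]; exact: AC.
exists v => // x.
have := Hs x; rewrite -[map A s]/(tval (in_tuple (map A s))) => /coord_span ->.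
elim/big_ind : _ => [|M N [a va] [b vb]|i _].
- by exists 0; rewrite mulmx0 scale0r.
- by exists (a + b); rewrite mulmxDr va vb scalerDl.
have /vs : (map A s)`_i \in map A s by rewrite mem_nth.
move=> /sub_rVP[a va]; exists (coord (in_tuple (map A s)) i (A x) * a).
by rewrite -scalemxAr va scalerA.
Qed.

(** p + i q is a common eigenvector over the complexification, with eigenvalue a x + i b x; the
    equations are its real and imaginary parts. *)
Lemma commuting_real_eigenvectors (F : rcfType) (n : nat) (X : Type)
    (A : X -> 'M[F]_n) : (0 < n)%N -> (forall x y, A x *m A y = A y *m A x) ->
  exists (p q : 'rV[F]_n) (a b : X -> F), (p != 0) || (q != 0) /\
    forall x, p *m A x = a x *: p - b x *: q /\ q *m A x = b x *: p + a x *: q.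
Proof.
move=> n0 AC; pose j : {rmorphism F -> F[i]} := real_complex F.
have [|v v0 Hv] := @common_eigenvector_family F[i] n X (fun x => map_mx j (A x)) n0.
  by move=> x y; rewrite -!map_mxM AC.
have /boolp.choice[c Hc] := Hv.
exists (map_mx (@complex.Re F) v), (map_mx (@complex.Im F) v),
  (fun x => complex.Re (c x)), (fun x => complex.Im (c x)); split.
  rewrite -negb_and; apply: contra v0 => /andP[/eqP/rowP p0 /eqP/rowP q0].
  apply/eqP/rowP => i; move: (p0 i) (q0 i); rewrite !mxE.
  by case: (v 0 i) => a b /= -> ->.
have Hs (z : F[i]) (y : F) : z * j y = Complex (complex.Re z * y) (complex.Im z * y).
  case: z => a b; apply/eqP; rewrite eq_complex /j /=.
  by rewrite !mulr0 subr0 ?add0r ?addr0 !eqxx.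
move=> x; split; apply/rowP => i; have := congr1 (fun M : 'rV_n => M 0 i) (Hc x);
  rewrite !mxE; under eq_bigr do rewrite mxE Hs.
  move=> /(congr1 (@complex.Re F)); rewrite raddf_sum /=.
  under [in X in _ -> X]eq_bigr do rewrite !mxE.
  by move=> ->; case: (c x) (v 0 i) => a b [].
move=> /(congr1 (@complex.Im F)); rewrite raddf_sum /=.
under [in X in _ -> X]eq_bigr do rewrite !mxE.
by move=> ->; case: (c x) (v 0 i) => a b [] d e /=; rewrite addrC.
Qed.

(** * From an eigenspace of convolution to a nontrivial character *)

Section Character.
Variables (R : realType) (G : topologicalZmodType) (cG : compact [set: G]).

(** Symmetrize a Urysohn function and subtract its mean. The symmetrization is 0 at 0 and at least 1
    at [x1], so it is not constant. *)
Lemma even_mean_zero_kernel (x1 : G) : hausdorff_space G -> x1 != 0 ->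
  exists k : G -> R, [/\ continuous k, forall x, k (- x) = k x, mean k = 0 &
    exists x, k x != 0].
Proof.
move=> hG x10.
have cl1 (x : G) : closed [set x].
  exact/accessible_closed_set1/hausdorff_accessible.
have sep : uniform_separator [set (0 : G)] [set x1].
  have nG := compact_normal hG cG.
  have [H _] := @normal_separatorP R G; apply: (H nG) => //.
  apply/disjoints_subset => x /= -> xx; by move/eqP: x10; rewrite -xx.
pose f : G -> R := Urysohn [set 0] [set x1].
have cf : continuous f by exact: Urysohn_continuous.
have f0 : f 0 = 0 by apply: (Urysohn_sub0 (R := R) sep); exists 0.
have f1 : f x1 = 1 by apply: (Urysohn_sub1 (R := R) sep); exists x1.
have fp x : 0 <= f x.
  have : [set` `[0, 1]] (f x) by apply: Urysohn_range; exists x.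
  by rewrite /= in_itv /= => /andP[].
pose k x := f x + f (- x) + - mean (fun x => f x + f (- x)).
have cff : continuous (fun x => f x + f (- x)) by continuity.
exists k; split.
- by rewrite /k; continuity.
- by move=> x; rewrite /k opprK (addrC (f x)).
- by rewrite /k meanD// ?mean_cst ?subrr//; continuity.
apply: contrapT => H; have k0 x : k x = 0.
  by apply/eqP; apply: contrapT => /negP kx; apply: H; exists x.
have := k0 0; have := k0 x1; have := fp (- x1); rewrite /k oppr0 f0 f1; lra.
Qed.

Definition orthonormal_in (P : (G -> R) -> Prop) (n : nat) (f : 'I_n -> G -> R) :=
  [/\ forall i, continuous (f i), forall i, P (f i) &
      forall i j, ip (f i) (f j) = (i == j)%:R].

Lemma orthonormal_extend (P : (G -> R) -> Prop) n (f : 'I_n -> G -> R) (g : G -> R) :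
  orthonormal_in P f -> continuous g -> P g -> ip g g = 1 ->
  (forall i, ip g (f i) = 0) -> exists f' : 'I_n.+1 -> G -> R, orthonormal_in P f'.
Proof.
move=> [cf Pf on] cg Pg g1 gf.
exists (fun i => oapp f g (unlift ord_max i)); split=> [i|i|i j].
- by case: unliftP => [j _|_] /=; [exact: cf|exact: cg].
- by case: unliftP => [j _|_] /=; [exact: Pf|exact: Pg].
case: unliftP => [i' ->|->]; case: unliftP => [j' ->|->] /=.
- by rewrite on (inj_eq lift_inj).
- by rewrite ipC gf eq_sym (negPf (neq_lift _ _)).
- by rewrite gf (negPf (neq_lift _ _)).
- by rewrite g1 eqxx.
Qed.

(** Sizes are bounded by [B], so some orthonormal family in [P] cannot be enlarged. An element of
    [P] different from its projection would enlarge it by its normalized residue. The nonzero [g]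
    excludes the empty family. *)
Lemma orthonormal_basis (P : (G -> R) -> Prop) (B : R) (g : G -> R) :
  (forall g h a, continuous g -> continuous h -> P g -> P h -> P (fun x => h x + a * g x)) ->
  (forall n (f : 'I_n -> G -> R), orthonormal_in P f -> n%:R <= B) ->
  continuous g -> P g -> (exists x, g x != 0) ->
  exists n (f : 'I_n.+1 -> G -> R), orthonormal_in P f /\
    forall h, continuous h -> P h -> h = fun x => \sum_i ip h (f i) * f i x.
Proof.
move=> PD PB cg Pg [x0 gx0].
have P0 : P (fun=> 0).
  have := PD g g (-1) cg cg Pg Pg.
  by rewrite (_ : (fun x => _) = fun=> 0)//; apply/funext => x; rewrite mulN1r subrr.
have PZ a h : continuous h -> P h -> P (fun x => a * h x).
  move=> ch Ph; have := PD h (fun=> 0) a ch (@cont_cst _ _ _) Ph P0.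
  by rewrite (_ : (fun x => _) = fun x => a * h x)//; apply/funext => x; rewrite add0r.
have ext n (f : 'I_n -> G -> R) h : orthonormal_in P f -> continuous h -> P h ->
    h <> (fun x => \sum_i ip h (f i) * f i x) ->
    exists f' : 'I_n.+1 -> G -> R, orthonormal_in P f'.
  move=> onf ch Ph hn; have [cf Pf on] := onf.
  pose q x := h x + (-1) * \sum_i ip h (f i) * f i x.
  have cp : continuous (fun x => \sum_i ip h (f i) * f i x).
    by apply: cont_sum => i; have := cf i => ?; continuity.
  have cq : continuous q by rewrite /q; continuity.
  have Pp : P (fun x => \sum_i ip h (f i) * f i x).
    have : forall s : seq 'I_n, P (fun x => \sum_(i <- s) ip h (f i) * f i x).
      elim=> [|i s IH]; first by under eq_fun do rewrite big_nil.
      under eq_fun do rewrite big_cons addrC.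
      apply: PD => //; apply: cont_sum => j; have := cf j => ?; continuity.
    exact.
  have Pq : P q by exact: PD.
  have qf i : ip q (f i) = 0.
    rewrite ipDl//; last by continuity.
    rewrite ipZl// [X in _ + _ * X]ipC ip_sumr// (bigD1 i)//= on eqxx mulr1 big1.
      by rewrite addr0 mulN1r subrr.
    by move=> j ji; rewrite on eq_sym (negPf ji) mulr0.
  have q0 : 0 < ip q q.
    rewrite lt_neqAle ip_ge0// andbT eq_sym; apply/eqP => /(ip_eq0 cG cq) qz.
    apply: hn; apply/funext => x; have := qz x; rewrite /q mulN1r => /eqP.
    by rewrite subr_eq0 => /eqP.
  pose a := (Num.sqrt (ip q q))^-1.
  have a2 : a * a = (ip q q)^-1 by rewrite /a -invfM -expr2 sqr_sqrtr// ltW.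
  have caq : continuous (fun x => a * q x) by continuity.
  apply: (orthonormal_extend (g := fun x => a * q x) onf) => //.
  - exact: PZ.
  - by rewrite ipZl// ipZr// mulrA a2 mulVf// lt0r_neq0.
  - by move=> i; rewrite ipZl// qf mulr0.
have [n [f [onf nf]]] : exists n (f : 'I_n -> G -> R), orthonormal_in P f /\
    ~ exists f' : 'I_n.+1 -> G -> R, orthonormal_in P f'.
  apply: contrapT => H.
  have all n : exists f : 'I_n -> G -> R, orthonormal_in P f.
    elim: n => [|n [f onf]]; first by exists (fun=> fun=> 0); split=> -[].
    by apply: contrapT => nf; apply: H; exists n, f.
  (* A family larger than the bound; the maximum with 0 makes the argument of [truncn]
     nonnegative. *)
  have [f /PB] := all (Num.truncn (Num.max 0 B)).+1.
  have := truncn_itv (x := Num.max 0 B).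
  rewrite le_max lexx => /(_ isT) /andP[_ H1] H2.
  by move: H1; rewrite gt_max => /andP[_]; rewrite ltNge H2.
have full h : continuous h -> P h -> h = fun x => \sum_i ip h (f i) * f i x.
  by move=> ch Ph; apply: contrapT => hn; apply: nf; exact: ext onf ch Ph hn.
case: n => [|n] in f onf nf full *; last by exists n, f.
have := congr1 (fun h => h x0) (full g cg Pg) => /=.
by rewrite big_ord0 => e; rewrite e eqxx in gx0.
Qed.

(* An eigenspace of convolution with an even kernel is translation-invariant
   and finite-dimensional, so the translations have a common complex
   eigenvector F in it, and F (y + x) = chi x * F y. *)
Lemma translation_eigenfunction (x1 : G) : hausdorff_space G -> x1 != 0 ->
  exists (p q : G -> R) (a b : G -> R), [/\ continuous p /\ continuous q,
    mean p = 0 /\ mean q = 0, exists y, (p y != 0) || (q y != 0) &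
    forall x y, p (y + x) = a x * p y - b x * q y /\
                q (y + x) = b x * p y + a x * q y].
Proof.
move=> hG x10; have [k [ck ek mk [x0 kx0]]] := even_mean_zero_kernel hG x10.
have [g [cg gn0 eg]] := eigenfunction cG ck ek kx0.
have L0 := conv_norm_gt0 cG ck ek kx0.
pose P (h : G -> R) := forall x, conv k (conv k h) x = conv_norm k * h x.
have [||n [f [[cf Pf on] full]]] := @orthonormal_basis P (ip k k / conv_norm k) g _ _ cg eg gn0.
- move=> u v a cu cv Pu Pv x; have cTu := continuous_conv cG ck cu; have cTv := continuous_conv cG ck cv.
  rewrite convD//; last by continuity.
  rewrite convZ// convD//; last by continuity.
  by rewrite convZ// Pu Pv; ring.
- move=> n f [cf Pf on]; rewrite ler_pdivlMr//.
  exact: orthonormal_eigen_bound cf Pf on.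
have cfi i x : continuous (fun y => f i (y + x)) by have := cf i => ?; continuity.
(* Translation by x in the basis [f]. It acts on coefficient rows from the right, and [A] will be a
   homomorphism from the commutative [G], so these matrices commute. *)
pose A x := \matrix_(i, j) ip (fun y => f i (y + x)) (f j).
have fA x y i : f i (y + x) = \sum_j A x i j * f j y.
  have Pfi : P (fun y => f i (y + x)).
    by move=> z; rewrite (conv_shift cG x ck (cf i)) (conv_shift cG x ck (continuous_conv cG ck (cf i))) Pf.
  rewrite (congr1 (fun h => h y) (full _ (cfi i x) Pfi)) /=.
  by apply: eq_bigr => j _; rewrite !mxE.
have AD x y : A (x + y) = A x *m A y.
  apply/matrixP => i l; rewrite !mxE.
  have -> : (fun z => f i (z + (x + y))) = fun z => \sum_j A x i j * f j (z + y).
    by apply/funext => z; rewrite [x + y]addrC addrA fA.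
  rewrite ipC ip_sumr//; apply: eq_bigr => j _.
  by rewrite ipC [A y j l]mxE.
have [//|p [q [a [b [pq0 eig]]]]] := commuting_real_eigenvectors (A := A) (ltn0Sn n) _.
  by move=> x y; rewrite -!AD addrC.
have cF (v : 'rV[R]_n.+1) : continuous (fun y => \sum_i v 0 i * f i y).
  by apply: cont_sum => i; have := cf i => ?; continuity.
(* Taking means in T^2 f = L f gives L * mean f = 0, because [k] has mean 0. *)
have mF (v : 'rV[R]_n.+1) : mean (fun y => \sum_i v 0 i * f i y) = 0.
  rewrite mean_sum//; last by move=> i; have := cf i => ?; continuity.
  rewrite big1// => i _; rewrite meanZ//.
  have : conv_norm k * mean (f i) = 0.
    rewrite -meanZ// -(_ : conv k (conv k (f i)) = fun x => conv_norm k * f i x); last exact/funext/Pf.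
    by rewrite mean_conv// ?mk ?mul0r//; exact: continuous_conv.
  by move=> /eqP; rewrite mulf_eq0 (negPf (lt0r_neq0 L0)) => /eqP ->; rewrite mulr0.
have F0 (v : 'rV[R]_n.+1) : (forall y, \sum_i v 0 i * f i y = 0) -> v = 0.
  move=> H; apply/rowP => j; rewrite mxE.
  have : ip (f j) (fun y => \sum_i v 0 i * f i y) = 0.
    rewrite (_ : (fun y => _) = fun=> 0); last exact/funext.
    by rewrite /ip; under eq_fun do rewrite mulr0; exact: mean_cst.
  rewrite ip_sumr// (bigD1 j)//= on eqxx mulr1 big1 ?addr0// => i ij.
  by rewrite on eq_sym (negPf ij) mulr0.
have FA (v : 'rV[R]_n.+1) x y : \sum_i v 0 i * f i (y + x) = \sum_j (v *m A x) 0 j * f j y.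
  under eq_bigr do rewrite fA big_distrr /=.
  rewrite exchange_big /=; apply: eq_bigr => j _; rewrite !mxE big_distrl /=.
  by apply: eq_bigr => i _; rewrite mulrA.
exists (fun y => \sum_i p 0 i * f i y), (fun y => \sum_i q 0 i * f i y), a, b; split=> //.
  apply: contrapT => H; move/negP: pq0; apply.
  have H' y : \sum_i p 0 i * f i y = 0 /\ \sum_i q 0 i * f i y = 0.
    apply: contrapT => /not_andP Hy; apply: H; exists y; apply/orP.
    by case: Hy => /eqP; [left|right].
  apply/negP; rewrite negb_or !negbK; apply/andP; split; apply/eqP/F0 => y;
    by case: (H' y).
move=> x y; rewrite !FA; case: (eig x) => -> ->; split.
  rewrite !big_distrr /= -sumrB; apply: eq_bigr => j _; rewrite !mxE; ring.
rewrite !big_distrr /= -big_split; apply: eq_bigr => j _; rewrite !mxE /=; ring.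
Qed.

(** The multiplier c + i s of the translation eigenfunction F = p + i q is continuous and
    multiplicative. If it were trivial, [p] and [q] would be constants of mean zero, so F would
    vanish. *)
Lemma nontrivial_character (x1 : G) : hausdorff_space G -> x1 != 0 ->
  exists c s : G -> R, [/\ continuous c /\ continuous s,
    forall x y, c (x + y) = c x * c y - s x * s y /\ s (x + y) = c x * s y + s x * c y,
    forall x, c x ^+ 2 + s x ^+ 2 = 1 & exists x, ~ (c x = 1 /\ s x = 0)].
Proof.
move=> hG x10; have [p [q [a [b [[cp cq] [mp mq] [y0 pq0] pqE]]]]] := translation_eigenfunction hG x10.
pose d := p y0 ^+ 2 + q y0 ^+ 2.
have d0 : 0 < d.
  rewrite /d; case/orP: pq0 => h.
    by rewrite ltr_wpDr ?sqr_ge0// lt_neqAle sqr_ge0 andbT eq_sym sqrf_eq0.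
  by rewrite ltr_wpDl ?sqr_ge0// lt_neqAle sqr_ge0 andbT eq_sym sqrf_eq0.
have dn0 := lt0r_neq0 d0.
(* a + i b is F (y0 + x) / F y0, with the denominator made real; this shows that it is
   continuous. *)
have aE x : a x = (p (y0 + x) * p y0 + q (y0 + x) * q y0) / d.
  by case: (pqE x y0) => -> ->; apply: (mulIf dn0); rewrite divfK// /d; ring.
have bE x : b x = (q (y0 + x) * p y0 - p (y0 + x) * q y0) / d.
  by case: (pqE x y0) => -> ->; apply: (mulIf dn0); rewrite divfK// /d; ring.
have ca : continuous a by rewrite (funext aE); continuity.
have cb : continuous b by rewrite (funext bE); continuity.
have ab x y : a (x + y) = a x * a y - b x * b y /\ b (x + y) = a x * b y + b x * a y.
  have -> : a (x + y) = (p (y0 + x + y) * p y0 + q (y0 + x + y) * q y0) / d by rewrite aE addrA.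
  have -> : b (x + y) = (q (y0 + x + y) * p y0 - p (y0 + x + y) * q y0) / d by rewrite bE addrA.
  case: (pqE y (y0 + x)) => -> ->; rewrite (aE x) (bE x); split; ring.
have ab0 : a 0 = 1 /\ b 0 = 0.
  rewrite aE bE addr0; split; last by rewrite [q y0 * _]mulrC subrr mul0r.
  by rewrite -!expr2 divff.
pose m x := a x ^+ 2 + b x ^+ 2.
have mD x y : m (x + y) = m x * m y by rewrite /m; case: (ab x y) => -> ->; ring.
have m0 : m 0 = 1 by rewrite /m; case: ab0 => -> ->; rewrite expr1n expr0n addr0.
have mge x : 0 <= m x by rewrite addr_ge0 ?sqr_ge0.
have mMn x n : m (x *+ n) = m x ^+ n.
  by elim: n => [|n IH]; rewrite ?mulr0n ?expr0// mulrS exprS mD IH.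
have cm : continuous m by rewrite (_ : m = fun x => a x * a x + b x * b x)//; continuity.
have [M M0 HM] := continuous_bounded cG cm.
have m1 x : m x <= 1.
  rewrite leNgt; apply/negP => mx.
  (* Bernoulli's inequality: if m x > 1, then m (x *+ n) = m x ^+ n is unbounded, against
     compactness. The reverse bound will come from m x * m (- x) = 1. *)
  have H n : 1 + (m x - 1) *+ n <= M.
    have : m (x *+ n) <= M by rewrite (le_trans (ler_norm _)).
    apply: le_trans; rewrite mMn; elim: n => [|n IH]; first by rewrite expr0 mulr0n addr0.
    rewrite exprS mulrS addrCA.
    have : 0 <= (m x - 1) *+ n by rewrite mulrn_wge0// subr_ge0 ltW.
    have : m x * (1 + (m x - 1) *+ n) <= m x * m x ^+ n by rewrite ler_wpM2l.
    move: ((m x - 1) *+ n) IH => t IH H1 H2.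
    have : 0 <= (m x - 1) * t by rewrite mulr_ge0// subr_ge0 ltW.
    lra.
  have e0 : 0 < m x - 1 by rewrite subr_gt0.
  have := truncnS_gt (M / (m x - 1)); rewrite ltr_pdivrMr// mulr_natl ltNge => /negP; apply.
  by apply: le_trans (H (Num.truncn (M / (m x - 1))).+1); rewrite lerDr.
exists a, b; split=> //.
  move=> x; apply/eqP; rewrite -/(m x) eq_le m1 /=.
  have := mD x (- x); rewrite subrr m0 => ->.
  by rewrite ler_piMr.
apply: contrapT => H.
have H1 x : a x = 1 /\ b x = 0 by apply: contrapT => Hx; apply: H; exists x.
have pE : p = fun=> p 0.
  by apply/funext => x; have [] := pqE x 0; case: (H1 x) => -> ->; rewrite add0r; lra.
have qE : q = fun=> q 0.
  by apply/funext => x; have [] := pqE x 0; case: (H1 x) => -> ->; rewrite add0r; lra.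
move: mp mq pq0; rewrite pE qE !mean_cst => -> ->.
by rewrite eqxx.
Qed.

End Character.

(** * Discrete groups, subgroups and local compactness *)

Definition disc (K : Type) : Type := K.

Section Disc.
Variable K : zmodType.

HB.instance Definition _ := GRing.Zmodule.on (disc K).
HB.instance Definition _ := hasNbhs.Build (disc K) principal_filter.
HB.instance Definition _ := Discrete_ofNbhs.Build (disc K) erefl.

Lemma disc_sub_continuous : continuous (fun x : disc K * disc K => x.1 - x.2).
Proof.
move=> [a b] U Uab; exists ([set a], [set b]).
  by split; rewrite nbhs_principalE; exact/principal_filterP.
by case=> x y /= [-> ->]; exact: nbhs_singleton Uab.
Qed.

HB.instance Definition _ :=
  PreTopologicalNmodule_isTopologicalZmodule.Build (disc K) disc_sub_continuous.

Lemma nbhs_disc (x : disc K) (U : set (disc K)) : U x -> nbhs x U.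
Proof. by move=> Ux; rewrite nbhs_principalE; exact/principal_filterP. Qed.

Lemma open_disc (U : set (disc K)) : open U.
Proof. by rewrite openE => x; exact: nbhs_disc. Qed.

Lemma continuous_disc (T : topologicalType) (f : disc K -> T) : continuous f.
Proof. by move=> x U /nbhs_singleton; exact: nbhs_disc. Qed.

Lemma LCA_disc : LCA (disc K).
Proof.
split; first exact: discrete_hausdorff.
move=> x _; exists [set x]; first by rewrite /within /= nbhs_principalE; exact/principal_filterP.
split; first exact: compact_set1.
exact/accessible_closed_set1/hausdorff_accessible/discrete_hausdorff.
Qed.

End Disc.

(* A subgroup with the subspace topology; the proof that it is a subgroup is an
   argument so that the group structure can be inferred. *)
Definition subgroup (G : zmodType) (S : set G) : Prop :=
  S 0 /\ forall x y, S x -> S y -> S (x - y).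

Definition subg (G : zmodType) (S : set G) (sS : subgroup S) : Type := set_type S.

Section Subg.
Variables (G : topologicalZmodType) (S : set G) (sS : subgroup S).

Definition subg_pred : {pred G} := fun x => x \in S.

Lemma subg_zmod_closed : zmod_closed subg_pred.
Proof.
split=> [|x y]; first exact/mem_set/sS.1.
by move=> /set_mem Sx /set_mem Sy; apply/mem_set/sS.2.
Qed.

HB.instance Definition _ := GRing.isZmodClosed.Build G subg_pred subg_zmod_closed.
HB.instance Definition _ := Topological.on (subg sS).
HB.instance Definition _ : isSub G subg_pred (subg sS) := SubType.on (set_type S).
HB.instance Definition _ := [SubChoice_isSubZmodule of subg sS by <:].

Lemma subg_val_continuous : continuous (val : subg sS -> G).
Proof. exact: (@initial_continuous _ _ (set_val : subg sS -> G)). Qed.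

Lemma continuous_subg (T : topologicalType) (f : T -> subg sS) :
  continuous (val \o f) -> continuous f.
Proof.
move=> /continuousP cf; apply/continuousP => _ [B oB <-].
exact: (cf B oB).
Qed.

Lemma subg_sub_continuous : continuous (fun x : subg sS * subg sS => x.1 - x.2).
Proof.
apply: continuous_subg => x.
rewrite (_ : _ \o _ = fun y : subg sS * subg sS => val y.1 - val y.2); last first.
  by apply/funext => y; exact: (raddfB (val : subg sS -> G)).
apply: (@continuous_comp _ _ _
  (fun y : subg sS * subg sS => (val y.1, val y.2)) (fun z : G * G => z.1 - z.2)).
  apply: cvg_pair; apply: continuous_comp; try exact: subg_val_continuous.
    exact: cvg_fst.
  exact: cvg_snd.
exact: sub_continuous.
Qed.

HB.instance Definition _ :=
  PreTopologicalNmodule_isTopologicalZmodule.Build (subg sS) subg_sub_continuous.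

Lemma subgP (x : subg sS) : S (val x).
Proof. exact: set_mem (valP x). Qed.

Definition mksubg (x : G) (Sx : S x) : subg sS := Sub x (mem_set Sx).

Lemma val_mksubg x (Sx : S x) : val (mksubg Sx) = x.
Proof. exact: SubK. Qed.

End Subg.

(** * Local compactness and neighbourhoods in subspaces and products *)

Lemma cluster_continuous (T U : topologicalType) (f : T -> U) (p q : T) :
  hausdorff_space U -> continuous f -> cluster (nbhs p) q -> f p = f q.
Proof.
move=> hU cf pq; apply: hU => V W Vp Wq.
have [z [Vz Wz]] := pq _ _ (cf _ _ Vp) (cf _ _ Wq).
by exists (f z).
Qed.

Lemma within_setT (T : Type) (F : set_system T) : within [set: T] F = F.
Proof.
apply/funext => P; rewrite /within /=; congr F.
by apply/funext => x; apply/propext; split=> // H; exact: H.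
Qed.

Section SetType.
Variables (T : topologicalType) (S : set T).

Lemma set_type_in (z : set_type S) : S (val z).
Proof. by case: z => z Sz; exact: set_mem Sz. Qed.

Lemma nbhs_set_type (z : set_type S) (W : set (set_type S)) :
  nbhs z W -> exists2 U, nbhs (val z) U & val @^-1` U `<=` W.
Proof.
move=> Wz; have [_ [[B oB <-] Bz] BW] : exists2 V, open_nbhs z V & V `<=` W.
  by rewrite nbhsE in Wz.
by exists B => //; exact: open_nbhs_nbhs.
Qed.

Lemma set_type_val_continuous : continuous (val : set_type S -> T).
Proof. exact: (@initial_continuous _ _ (set_val : set_type S -> T)). Qed.

Lemma hausdorff_set_type : hausdorff_space T -> hausdorff_space (set_type S).
Proof.
move=> hT p q pq; apply: val_inj.
exact: cluster_continuous hT set_type_val_continuous pq.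
Qed.

Lemma locally_compact_set_type : closed S ->
  locally_compact [set: T] -> locally_compact [set: set_type S].
Proof.
move=> clS lT x _; have [K Kx [cK clK]] := lT (val x) I.
exists (val @^-1` K).
  rewrite within_setT in Kx; rewrite within_setT; exact: set_type_val_continuous Kx.
split; last exact: preimage_closed (fun z _ => set_type_val_continuous (x := z)) clK.
move=> F PF FK; have /compact_closedI/(_ clS) cKS := cK.
have FKS : F (val @^-1` (K `&` S)).
  by apply: filterS FK => z Kz; split=> //; exact: set_type_in.
have [y [[Ky Sy] cly]] := cKS (fmap val F) _ FKS.
exists (exist _ y (mem_set Sy)); split=> //.
move=> A W FA /nbhs_set_type[U] /= Uy UW.
have FvA : F (val @^-1` (val @` A)) by apply: filterS FA => z Az; exists z.
have [_ [[z Az <-] Uz]] := cly _ _ FvA Uy.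
by exists z; split=> //; exact: UW.
Qed.

End SetType.

Lemma LCA_subg (G : topologicalZmodType) (S : set G) (sS : subgroup S) :
  closed S -> LCA G -> LCA (subg sS).
Proof.
by move=> clS [hG lG]; split; [exact: hausdorff_set_type|exact: locally_compact_set_type].
Qed.

Lemma LCA_clUlm (G : topologicalZmodType) : LCA G -> LCA (clUlm G).
Proof.
move=> [hG lG]; split; first exact: hausdorff_set_type.
by apply: locally_compact_set_type => //; exact: closed_closure.
Qed.

Lemma LCA_compact (G : topologicalZmodType) :
  hausdorff_space G -> compact [set: G] -> LCA G.
Proof.
move=> hG cG; split=> // x _; exists [set: G]; last by split=> //; exact: closedT.
exact: filterT.
Qed.

Lemma LCA_dsum (A C : topologicalZmodType) : LCA A -> LCA C -> LCA (dsum A C).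
Proof.
move=> [hA lA] [hC lC]; split.
  move=> [a c] [a' c'] H; congr pair.
    by apply: (@cluster_continuous (A * C)%type A fst (a, c) (a', c')) => // x; exact: cvg_fst.
  by apply: (@cluster_continuous (A * C)%type C snd (a, c) (a', c')) => // x; exact: cvg_snd.
move=> [a c] _; have [K Ka [cK clK]] := lA a I; have [L Lc [cL clL]] := lC c I.
exists (K `*` L).
  rewrite within_setT in Ka; rewrite within_setT in Lc; rewrite within_setT.
  by exists (K, L).
split; first exact: compact_setX.
by apply: closedI; apply: preimage_closed => // z _; [exact: cvg_fst|exact: cvg_snd].
Qed.

Lemma LCA_real (R : realType) : LCA R.
Proof.
split; first exact: Rhausdorff.
move=> x _; exists [set` `[x - 1, x + 1]].
  rewrite within_setT.
  have : nbhs x [set` `[x - 1, x + 1]].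
    have /cvgrPdist_le/(_ 1 ltr01) : (fun y : R => y) @ x --> x by exact: cvg_id.
    apply: filterS => y; rewrite /= in_itv /= ler_distl => /andP[? ?]; apply/andP; split; lra.
  by apply: filterS => y.
by split; [exact: segment_compact|exact: itv_closed].
Qed.

Lemma nbhs_dsum0 (A C : topologicalZmodType) (W : set (dsum A C)) : nbhs (0 : dsum A C) W ->
  exists U V, [/\ nbhs (0 : A) U, nbhs (0 : C) V & forall x y, U x -> V y -> W (x, y)].
Proof.
move=> [[U V] /= [U0 V0] UVW]; exists U, V; split=> // x y Ux Vy.
exact: (UVW (x, y)).
Qed.

Lemma nbhs_addl (G : topologicalZmodType) (x : G) (U : set G) :
  nbhs x U -> nbhs (0 : G) [set u | U (x + u)].
Proof.
move=> Ux; have := @add_continuous G (x, 0) U; rewrite /= addr0 => /(_ Ux).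
move=> [[V W] /= [Vx W0] VW]; apply: filterS W0 => u Wu.
by apply: (VW (x, u)); split=> //; exact: nbhs_singleton.
Qed.

Lemma nbhs_subl (G : topologicalZmodType) (x : G) (U : set G) :
  nbhs (0 : G) U -> nbhs x [set y | U (y - x)].
Proof.
move=> U0; have := @sub_continuous G (x, x) U; rewrite /= subrr => /(_ U0).
move=> [[V W] /= [Vx W0] VW]; apply: filterS Vx => u Wu.
by apply: (VW (u, x)); split=> //; exact: nbhs_singleton.
Qed.

Lemma open_hom (A B : topologicalZmodType) (f : {additive A -> B}) :
  (forall W, nbhs (0 : A) W -> nbhs (0 : B) (f @` W)) -> forall U, open U -> open (f @` U).
Proof.
move=> H U; rewrite !openE => oU _ [x Ux <-].
have := nbhs_subl (f x) (H _ (nbhs_addl (oU x Ux))).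
rewrite /interior; apply: filterS => y [u /= Uxu e].
by exists (x + u) => //; rewrite raddfD e addrC subrK.
Qed.

Lemma proper_open_hom (A B : topologicalZmodType) (f : {additive A -> B}) :
  (forall W, nbhs (0 : A) W -> nbhs (0 : B) (f @` W)) -> proper_hom f.
Proof.
move=> H U oU; exists (f @` U); first exact: open_hom.
by apply/seteqP; split=> [y [x Ux <-]|y []//]; split; exists x.
Qed.

(** [V] isolates 0 in the image, and its translates isolate every other image point, so [f] is
    injective with discrete image. *)
Lemma proper_disc_hom (K : zmodType) (B : topologicalZmodType)
    (f : {additive disc K -> B}) (V : set B) :
  nbhs (0 : B) V -> (forall a, V (f a) -> a = 0) -> proper_hom f.
Proof.
move=> V0 Vf U _; pose W := \bigcup_(a in U) [set y | V (y - f a)]°.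
exists W; first by apply: bigcup_open => a _; exact: open_interior.
apply/seteqP; split=> [_ [a Ua <-]|y [[a Ua Va] [b _ eb]]].
  split; last by exists a.
  by exists a => //; exact: nbhs_subl.
rewrite -eb in Va *; have := interior_subset Va; rewrite /= -raddfB => /Vf/eqP.
by rewrite subr_eq0 => /eqP ->; exists a.
Qed.

(** The section is the inclusion of the second summand followed by [gamma]. *)
Lemma splits_section (A B C : topologicalZmodType)
    (phi : contAdditive A B) (psi : contAdditive B C) : splits phi psi ->
  exists s : {additive C -> B}, continuous s /\ cancel s psi.
Proof.
move=> [beta [gamma [bK gK _ psib]]].
pose s (c : C) : B := gamma (0, c).
have sB : zmod_morphism s.
  move=> x y; rewrite /s -raddfB; congr (gamma _).
  by apply/pair_equal_spec; rewrite /= subr0.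
pose S := GRing.isZmodMorphism.Build C B s sB.
exists (HB.pack_for {additive C -> B} s S); split.
  move=> c; apply: (@continuous_comp _ _ _ (fun c : C => (0, c) : dsum A C) gamma).
    by apply: cvg_pair; [exact: cvg_cst|exact: cvg_id].
  exact: cts_fun.
by move=> c; rewrite -psib /= gK.
Qed.

(** * A criterion for TFU extensions *)

Section TFU.
Variables (A B C : topologicalZmodType).
Variables (phi : contAdditive A B) (psi : contAdditive B C).

(** Local compactness of the closures and injectivity and properness of the restricted [phi] are
    inherited. The three hypotheses supply the rest: exactness in the middle, surjectivity, and
    openness of the restricted [psi] at 0. *)
Lemma tfu_extensionI : extension phi psi ->
  (forall b, closure (ulm1 B) b -> psi b = 0 ->
     exists2 a, closure (ulm1 A) a & phi a = b) ->
  (forall c, closure (ulm1 C) c -> exists2 b, closure (ulm1 B) b & psi b = c) ->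
  (forall W, nbhs (0 : B) W -> exists2 V, nbhs (0 : C) V & forall c, V c ->
     closure (ulm1 C) c -> exists b, [/\ W b, closure (ulm1 B) b & psi b = c]) ->
  tfu_extension phi psi.
Proof.
move=> ext; have [[LA LB LC] [[iphi rphi rpsi] pphi ppsi]] := ext => H1 H2 H3.
split=> //; split; first by split; exact: LCA_clUlm.
have mem (G : topologicalZmodType) (x : clUlm G) : closure (ulm1 G) (val x).
  exact: set_mem (valP x).
have psiphi a : psi (phi a) = 0.
  have : range phi (phi a) by exists a.
  by rewrite rphi.
split.
- split.
  + move=> x y /(congr1 val); rewrite !val_clUlm_map => /iphi; exact: val_inj.
  + apply/seteqP; split=> [_ [a _ <-]|b].
      by apply: (@val_inj _ _ (clUlm C)); rewrite !val_clUlm_map psiphi raddf0.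
    move=> /(congr1 val); rewrite val_clUlm_map raddf0 => pb.
    have [a Aa ab] := H1 _ (mem _ b) pb.
    exists (Sub a (mem_set Aa)) => //.
    by apply: (@val_inj _ _ (clUlm _)); rewrite val_clUlm_map SubK.
  + apply/seteqP; split=> // c _; have [b Bb bc] := H2 _ (mem _ c).
    exists (Sub b (mem_set Bb)) => //.
    by apply: (@val_inj _ _ (clUlm _)); rewrite val_clUlm_map SubK.
- move=> _ [U oU <-]; have [V oV UV] := pphi U oU.
  exists (val @^-1` V); first by exists V.
  apply/seteqP; split=> [_ [a Ua <-]|b [Vb [a _ ab]]].
    split; last by exists a.
    have : (phi @` U) (phi (val a)) by exists (val a).
    by rewrite UV => -[Vp _]; exact: (eq_ind_r V Vp (val_clUlm_map phi a)).
  exists a => //; have : (phi @` U) (val b).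
    by rewrite UV; split=> //; exists (val a) => //; rewrite -ab val_clUlm_map.
  by move=> [a' Ua']; rewrite -ab val_clUlm_map => /iphi e; exact: (eq_ind _ U Ua' _ e).
- apply: proper_open_hom => W /nbhs_set_type[U U0 UW].
  have [V V0 HV] := H3 U U0.
  have V0' : nbhs (val (0 : clUlm C)) V by exact: V0.
  have N0 : \forall c \near (0 : clUlm C), V (val c) := clUlm_val_continuous V0'.
  apply: filterS N0 => c Vc.
  have [b [Ub Bb bc]] := HV _ Vc (mem _ c).
  exists (Sub b (mem_set Bb)); first by apply: UW; exact: Ub.
  by apply: (@val_inj _ _ (clUlm _)); rewrite val_clUlm_map; exact: bc.
Qed.

End TFU.

(** * The extension defined by an open subgroup *)

Section Ulm.
Variables (G : topologicalZmodType) (cG : compact [set: G]).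

Lemma continuous_mulrn (n : nat) : continuous (fun x : G => x *+ n).
Proof.
elim: n => [|n IH]; first by under eq_fun do rewrite mulr0n; exact: cst_continuous.
by under eq_fun do rewrite mulrS; apply: cont_addG => //; exact: cont_id.
Qed.

(** Each nG is a continuous image of a compact group, hence closed. So closures of the Ulm subgroup
    of [G] add nothing. *)
Lemma closed_ulm1 : hausdorff_space G -> closed (ulm1 G).
Proof.
move=> hG; apply: closed_bigI => n _; apply: compact_closed => //.
apply: continuous_compact => //.
by apply: continuous_subspaceT; exact: continuous_mulrn.
Qed.

Lemma torsion_free_inj (n : nat) (x y : G) :
  torsion_free G -> (0 < n)%N -> x *+ n = y *+ n -> x = y.
Proof.
move=> tf n0 e; apply/eqP; rewrite -subr_eq0; apply/eqP; apply: (tf n) => //.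
by rewrite mulrnBl e subrr.
Qed.

(** Division by n is unique in a torsion-free group, so a quotient of x by m * n is also a quotient
    of y by m. *)
Lemma ulm1_divisible (n : nat) (x : G) : torsion_free G -> (0 < n)%N -> ulm1 G x ->
  exists2 y, ulm1 G y & y *+ n = x.
Proof.
move=> tf n0 ux; have [y _ yx] := ux n n0; exists y => // m m0.
have nm0 : (0 < m * n)%N by rewrite muln_gt0 m0.
have [z _ zx] := ux (m * n)%N nm0; exists z => //.
by apply: (torsion_free_inj tf n0); rewrite -mulrnA zx yx.
Qed.

(** Compactness makes G / H finite. The exponent is the product of annihilating exponents over
    finitely many coset representatives. *)
Lemma open_subgroup_exponent (H : set G) : subgroup H -> open H ->
  exists2 m : nat, (0 < m)%N & forall x, H (x *+ m).
Proof.
move=> [H0 HB] oH.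
have HN x : H x -> H (- x) by move=> Hx; rewrite -sub0r; exact: HB.
have HD x y : H x -> H y -> H (x + y) by move=> Hx Hy; rewrite -[y]opprK; apply/HB/HN.
have HM x n : H x -> H (x *+ n).
  by move=> Hx; elim: n => [|n IH]; rewrite ?mulr0n// mulrS; exact: HD.
have [t [_ Ht]] := translates_cover cG (open_nbhs_nbhs (conj oH H0)).
have tors x : exists2 n : nat, (0 < n)%N & H (x *+ n).
  (* Pigeonhole: [idx n] records a representative of the coset of x *+ n. Among size t + 1 multiples
     two share it, and their difference lies in [H]. *)
  pose idx (n : nat) := index (xget 0 [set a | a \in t /\ H (x *+ n + a)]) t.
  have Hidx n : H (x *+ n + nth 0 t (idx n)) /\ (idx n < size t)%N.
    rewrite /idx; case: xgetP => [a -> [at_ Ha]|/(_ _) no].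
      by rewrite nth_index// index_mem.
    by have [a at_ Ha] := Ht (x *+ n); case: (no a).
  have [i [j [ij e]]] : exists i j : 'I_(size t).+1, (i < j)%N /\ idx i = idx j.
    pose f (i : 'I_(size t).+1) := Ordinal (Hidx i).2.
    have /injectivePn[i [j ij e]] : ~~ injectiveb f.
      by apply/injectiveP => /leq_card; rewrite !card_ord ltnn.
    have e' : idx i = idx j by exact: (congr1 val e).
    case: (ltngtP i j) => ij'; [by exists i, j|by exists j, i|].
    by move: ij; rewrite -val_eqE /= ij' eqxx.
  exists (j - i)%N; first by rewrite subn_gt0.
  have [Hi _] := Hidx i; have [Hj _] := Hidx j; have := HB _ _ Hj Hi.
  by rewrite e opprD addrACA subrr addr0 mulrnBr// ltnW.
pose N a := xget 1%N [set n : nat | (0 < n)%N /\ H (a *+ n)].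
have HN' a : (0 < N a)%N /\ H (a *+ N a).
  by rewrite /N; case: xgetP => [n -> //|no]; have [n n0 Hn] := tors a; case: (no n).
exists (\prod_(a <- t) N a)%N.
  by elim: t {Ht tors N HN'} (N) HN' => [|a t IH] N HN'; rewrite ?big_nil ?big_cons ?muln_gt0 ?(HN' a).1 ?IH.
move=> x; have [a at_ Ha] := Ht x.
rewrite -[x](addrK a) mulrnBl; apply: HB; first exact: HM.
by rewrite (big_rem a)//= mulrnA; apply: HM; exact: (HN' a).2.
Qed.

End Ulm.

Lemma open_subgroup_closed (G : topologicalZmodType) (H : set G) :
  subgroup H -> open H -> closed H.
Proof.
move=> [H0 HB] oH x /(_ _ (nbhs_subl x (open_nbhs_nbhs (conj oH H0)))) [y [Hy Hyx]].
by rewrite -[x](subKr y); exact: HB.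
Qed.

Lemma dsum_mulrn (A C : topologicalZmodType) (z : dsum A C) (n : nat) :
  z *+ n = (z.1 *+ n, z.2 *+ n).
Proof. by elim: n => [|n IH]; rewrite ?mulr0n// !mulrS IH. Qed.

Section OpenSubgroup.
Variables (G : topologicalZmodType) (cG : compact [set: G]) (hG : hausdorff_space G).
Variables (tf : torsion_free G) (H : set G) (sH : subgroup H) (oH : open H).

Let D := dsum G (disc G).

(* openB is H x (G discrete), realized inside G x (G discrete). *)
Definition openB_set : set D := [set z | H z.1].

Lemma openB_subgroup : subgroup openB_set.
Proof. by split=> [|x y]; [exact: sH.1|exact: sH.2]. Qed.

Definition openB := subg openB_subgroup.
Definition openX := disc (subg sH).

Lemma subgroupN x : H x -> H (- x).
Proof. by move=> Hx; rewrite -sub0r; apply: sH.2 => //; exact: sH.1. Qed.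

Definition openB_mk (x y : G) (Hx : H x) : openB :=
  @mksubg D openB_set openB_subgroup (x, y) Hx.

Lemma val_openB_mk x y (Hx : H x) : val (openB_mk y Hx) = (x, y).
Proof. exact: val_mksubg. Qed.

(** The first coordinate is implicit in the membership proof: h goes to (-h, h), which parametrizes
    the kernel of addition. *)
Definition openB_phi (h : openX) : openB :=
  openB_mk (val h) (subgroupN (subgP (h : subg sH))).
Definition openB_psi (z : openB) : G := (val z).1 + (val z).2.

Lemma openB_phi_zmod_morphism : zmod_morphism openB_phi.
Proof.
move=> x y; apply: val_inj; rewrite [RHS]raddfB !val_openB_mk (raddfB (val : subg sH -> G)).
by apply/pair_equal_spec; split=> //=; rewrite opprD.
Qed.

Lemma openB_psi_zmod_morphism : zmod_morphism openB_psi.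
Proof. by move=> x y; rewrite /openB_psi raddfB /= addrACA opprD. Qed.

Lemma openB_psi_continuous : continuous openB_psi.
Proof.
have cv : continuous (val : openB -> D) by exact: subg_val_continuous.
apply: cont_addG; first exact: (cont_comp (@cont_fst G (disc G)) cv).
apply: (cont_comp (h := fun x : disc G => x : G)).
  exact: continuous_disc.
exact: (cont_comp (@cont_snd G (disc G)) cv).
Qed.

HB.instance Definition _ :=
  GRing.isZmodMorphism.Build openX openB openB_phi openB_phi_zmod_morphism.
HB.instance Definition _ :=
  @isContinuous.Build openX openB openB_phi (@continuous_disc _ _ _).
HB.instance Definition _ :=
  GRing.isZmodMorphism.Build openB G openB_psi openB_psi_zmod_morphism.
HB.instance Definition _ :=
  @isContinuous.Build openB G openB_psi openB_psi_continuous.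

Lemma nbhs_openB0 (W : set openB) : nbhs (0 : openB) W ->
  exists2 U, nbhs (0 : G) U & forall x (Hx : H x), U x -> W (openB_mk 0 Hx).
Proof.
move=> /nbhs_set_type[U' U'0 U'W].
have /nbhs_dsum0[U [V [U0 V0 UV]]] : nbhs (0 : D) U' by exact: U'0.
exists U => // x Hx Ux; apply: U'W; exact: UV Ux (nbhs_singleton V0).
Qed.

Lemma openB_snd_continuous : continuous (fun z : openB => (val z).2).
Proof.
have cv : continuous (val : openB -> D) by exact: subg_val_continuous.
exact: (cont_comp (@cont_snd G (disc G)) cv).
Qed.

Lemma openB_snd0 : nbhs (0 : openB) [set z | (val z).2 = 0].
Proof.
have N0 : nbhs ((val (0 : openB)).2 : disc G) [set 0] by exact: nbhs_disc.
exact: openB_snd_continuous N0.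
Qed.

(** The kernel meets the open slice with second coordinate 0 only in 0, so it is discrete. The map
    [openB_psi] is open because it restricts on that slice to the inclusion of the open subgroup
    [H]. *)
Lemma openB_extension :
  extension (openB_phi : contAdditive openX openB) (openB_psi : contAdditive openB G).
Proof.
have kerP z : openB_psi z = 0 -> (val z).2 = - (val z).1.
  by rewrite /openB_psi => /eqP; rewrite addrC addr_eq0 => /eqP.
split; split.
- exact: LCA_disc.
- apply: LCA_subg; last by apply: LCA_dsum; [exact: LCA_compact|exact: LCA_disc].
  apply: (@preimage_closed (dsum G (disc G)) G fst) => [z _|]; first exact: cvg_fst.
  exact: open_subgroup_closed.
- exact: LCA_compact.
- split.
  + move=> x y /(congr1 val); rewrite !val_openB_mk => -[_ e]; exact: val_inj.
  + apply/seteqP; split=> [_ [h _ <-]|z /kerP ez].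
      by rewrite /= /openB_psi val_openB_mk /= addNr.
    exists (mksubg sH (subgroupN (subgP z))) => //; apply: val_inj.
    rewrite val_openB_mk val_mksubg [RHS]surjective_pairing; apply/pair_equal_spec.
    split; first exact: opprK.
    by rewrite -ez.
  + apply/seteqP; split=> // x _.
    by exists (openB_mk x sH.1) => //; rewrite /= /openB_psi val_openB_mk /= add0r.
- apply: (proper_disc_hom openB_snd0) => h h0.
  by apply: (@val_inj _ _ (subg sH)); exact: h0.
- apply: proper_open_hom => W /nbhs_openB0[U U0 UW].
  have HU : nbhs (0 : G) (U `&` H).
    apply: filterI => //; exact: open_nbhs_nbhs (conj oH sH.1).
  apply: filterS HU => x [Ux Hx].
  exists (openB_mk 0 Hx); first exact: UW.
  by rewrite /= /openB_psi val_openB_mk /= addr0.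
Qed.

Lemma ulm1_open_subgroup x : ulm1 G x -> H x.
Proof.
have [m m0 Hm] := open_subgroup_exponent cG sH oH.
by move=> /(_ m m0)[y _ <-].
Qed.

(** For the converse, the quotient of the first coordinate must lie in [H]; it can be chosen in
    [ulm1 G], which [H] contains. *)
Lemma ulm1_openB z : ulm1 openB z <-> ulm1 G (val z).1 /\ ulm1 G (val z).2.
Proof.
split=> [uz|[u1 u2] n n0].
  split=> n n0; have [w _ <-] := uz n n0; rewrite raddfMn /= dsum_mulrn /=;
    by [exists (val w).1|exists (val w).2].
have [y1 uy1 e1] := ulm1_divisible tf n0 u1; have [y2 uy2 e2] := ulm1_divisible tf n0 u2.
exists (openB_mk y2 (ulm1_open_subgroup uy1)) => //.
apply: val_inj; rewrite raddfMn dsum_mulrn [RHS]surjective_pairing.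
by apply/pair_equal_spec; split; [exact: e1|exact: e2].
Qed.

Lemma closure_ulm1_openB z : closure (ulm1 openB) z ->
  ulm1 G (val z).1 /\ ulm1 G (val z).2.
Proof.
pose DD : set openB := [set z | ulm1 G (val z).1] `&` [set z | ulm1 G (val z).2].
have clDD : closed DD.
  apply: closedI.
    apply: (@preimage_closed openB G (fun z => (val z).1)); last exact: closed_ulm1.
    move=> x _; apply: (cont_comp (@cont_fst G (disc G))); exact: subg_val_continuous.
  apply: (@preimage_closed openB (disc G) (fun z => (val z).2)).
    by move=> x _; exact: openB_snd_continuous.
  by rewrite -openC; exact: open_disc.
move=> clz; apply: clDD; apply: closureS clz => w; exact: (ulm1_openB w).1.
Qed.

(** An element x of [ulm1 G] lifts to (x, 0), which lies in the Ulm subgroup of [openB] and is as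
    close to 0 as x is. *)
Lemma openB_tfu :
  tfu_extension (openB_phi : contAdditive openX openB) (openB_psi : contAdditive openB G).
Proof.
have clD : closure (ulm1 G) `<=` ulm1 G by exact: closed_ulm1.
have B0 := ulm1_open_subgroup.
have u0 := @ulm1_0 G.
apply: tfu_extensionI; first exact: openB_extension.
- move=> z uz z0.
  (* The kernel description in [openB_extension] turns [z0] into a preimage of z. *)
  have [_ [_ _ rphi]] : True /\ [/\ True, True & range openB_phi z].
    by have [_ [[_ -> _] _ _]] := openB_extension.
  case: rphi => h _ hz; exists h => //; apply: subset_closure => n n0.
  have [_] := closure_ulm1_openB uz; rewrite -hz val_openB_mk /= => uh.
  have [y uy e] := ulm1_divisible tf n0 uh.
  exists (mksubg sH (ulm1_open_subgroup uy)) => //; apply: val_inj.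
  by rewrite (raddfMn (val : subg sH -> G)); exact: e.
- move=> c /clD uc; exists (openB_mk 0 (B0 _ uc)).
    by apply/subset_closure/ulm1_openB; rewrite val_openB_mk.
  by rewrite /= /openB_psi val_openB_mk /= addr0.
- move=> W /nbhs_openB0[U U0 UW]; exists U => // c Uc /clD uc.
  exists (openB_mk 0 (B0 _ uc)); split; first exact: UW.
    by apply/subset_closure/ulm1_openB; rewrite val_openB_mk.
  by rewrite /= /openB_psi val_openB_mk /= addr0.
Qed.

(** The second coordinate t of a section is continuous into a discrete group, so its kernel is open
    and contains some mG. Then t x *+ m = 0, hence t x = 0, and x equals the first coordinate of its
    lift, which is in [H]. *)
Lemma openB_split :
  splits (openB_phi : contAdditive openX openB) (openB_psi : contAdditive openB G) ->
  H = setT.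
Proof.
move=> /splits_section[s [cs sK]].
pose t x := (val (s x)).2.
have tB x y : t (x - y) = t x - t y by rewrite /t !raddfB.
have t0 : t 0 = 0 by rewrite -[X in t X](subrr 0) tB subrr.
have tMn x n : t (x *+ n) = t x *+ n by rewrite /t !raddfMn.
pose N := [set x | t x = 0].
have sN : subgroup N by split=> // x y Nx Ny; rewrite /N /= tB Nx Ny subrr.
have oN : open N.
  apply: (@open_comp G (disc G) t [set 0]); last exact: open_disc.
  by move=> x _; exact: (cont_comp openB_snd_continuous cs).
have [m m0 Hm] := open_subgroup_exponent cG sN oN.
apply/seteqP; split=> // x _; have tx : t x = 0 by apply: (tf m0); rewrite -tMn; exact: Hm.
have := sK x; rewrite /= /openB_psi -/(t x) tx addr0 => <-.
exact: (subgP (s x)).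
Qed.

End OpenSubgroup.

(** * The extension defined by a character *)

(* The circle group R / 2 pi Z, as pairs (cos, sin) under complex
   multiplication written additively. *)
Definition circle (R : realType) : Type := {z : R * R | z.1 ^+ 2 + z.2 ^+ 2 == 1}.

Section Circle.
Variable R : realType.

HB.instance Definition _ := Choice.on (circle R).
HB.instance Definition _ : isSub (R * R)%type (fun z : (R * R)%type => z.1 ^+ 2 + z.2 ^+ 2 == 1) (circle R) :=
  SubType.on {z : R * R | z.1 ^+ 2 + z.2 ^+ 2 == 1}.

Implicit Types z w : circle R.

Lemma circleP z : (val z).1 ^+ 2 + (val z).2 ^+ 2 = 1.
Proof. exact/eqP/(valP z). Qed.

Lemma circle_eq z w : (val z).1 = (val w).1 -> (val z).2 = (val w).2 -> z = w.
Proof.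
by move=> e1 e2; apply: val_inj; rewrite [LHS]surjective_pairing e1 e2 -surjective_pairing.
Qed.

Definition circle_mk (a b : R) (ab : a ^+ 2 + b ^+ 2 = 1) : circle R :=
  exist _ (a, b) (introT eqP ab).

Lemma circle0_subproof : (1 : R) ^+ 2 + (0 : R) ^+ 2 = 1.
Proof. by rewrite expr1n expr0n addr0. Qed.

Lemma circle_opp_subproof z : (val z).1 ^+ 2 + (- (val z).2) ^+ 2 = 1.
Proof. by rewrite sqrrN circleP. Qed.

Lemma circle_add_subproof z w :
  ((val z).1 * (val w).1 - (val z).2 * (val w).2) ^+ 2 +
  ((val z).1 * (val w).2 + (val z).2 * (val w).1) ^+ 2 = 1.
Proof.
transitivity (((val z).1 ^+ 2 + (val z).2 ^+ 2) * ((val w).1 ^+ 2 + (val w).2 ^+ 2)); first by ring.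
by rewrite !circleP mulr1.
Qed.

Definition circle0 : circle R := circle_mk circle0_subproof.
Definition circle_opp z : circle R := circle_mk (circle_opp_subproof z).
Definition circle_add z w : circle R := circle_mk (circle_add_subproof z w).

Lemma circle_addA : associative circle_add.
Proof. by move=> x y z; apply: circle_eq => /=; ring. Qed.

Lemma circle_addC : commutative circle_add.
Proof. by move=> x y; apply: circle_eq => /=; ring. Qed.

Lemma circle_add0 : left_id circle0 circle_add.
Proof. by move=> x; apply: circle_eq => /=; ring. Qed.

Lemma circle_addN : left_inverse circle0 circle_opp circle_add.
Proof.
move=> x; apply: circle_eq => /=; last by ring.
by apply: etrans (circleP x) => /=; ring.
Qed.

HB.instance Definition _ := GRing.isZmodule.Build (circle R)
  circle_addA circle_addC circle_add0 circle_addN.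

Definition circle_exp (r : R) : circle R := circle_mk (cos2Dsin2 r).

Lemma circle_expB : zmod_morphism circle_exp.
Proof.
move=> x y; apply: circle_eq => /=.
  by rewrite cosB mulrN opprK.
by rewrite sinB; ring.
Qed.

HB.instance Definition _ := GRing.isZmodMorphism.Build R (circle R) circle_exp circle_expB.

(** Since pi >= 2, the interval [-1, 1] lies where the sine is injective. This makes the kernel of
    [circle_exp] discrete. *)
Lemma circle_exp_eq0 (r : R) : `|r| <= 1 -> circle_exp r = 0 -> r = 0.
Proof.
rewrite ler_norml => /andP[r1 r2] /(congr1 (fun z : circle R => (val z).2)) /= s0.
have p2 := pi_ge2 R.
have rK : asin (sin r) = r by apply: sinK; rewrite in_itv /=; apply/andP; split; lra.
have zK : asin (sin (0 : R)) = 0 by apply: sinK; rewrite in_itv /=; apply/andP; split; lra.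
by rewrite -rK s0 -[X in asin X]sin0 zK.
Qed.

End Circle.

(** * The extension by the discrete real line *)

Section Cover.
Variables (R : realType) (G : topologicalZmodType).
Variables (cG : compact [set: G]) (hG : hausdorff_space G).
Variables (c s : G -> R) (cc : continuous c) (cs : continuous s).
Hypothesis chiD : forall x y,
  c (x + y) = c x * c y - s x * s y /\ s (x + y) = c x * s y + s x * c y.
Hypothesis chi1 : forall x, c x ^+ 2 + s x ^+ 2 = 1.

Definition chi (x : G) : circle R := circle_mk (chi1 x).

Lemma chi_zmod_morphism : zmod_morphism chi.
Proof.
have D x y : chi (x + y) = chi x + chi y.
  by case: (chiD x y) => e1 e2; apply: circle_eq.
by move=> x y; apply/eqP; rewrite eq_sym subr_eq -D subrK.
Qed.

HB.instance Definition _ := GRing.isZmodMorphism.Build G (circle R) chi chi_zmod_morphism.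

Let L := dsum G R.
Let D := dsum L (disc (circle R)).

(* covB is the graph of (x, r) |-> chi x - e r, which gives G x R the topology in
   which { (x, r) | chi x = e r } with its usual topology is open. *)
Definition covB_set : set D := [set z | z.2 = chi z.1.1 - circle_exp z.1.2].

Lemma covB_subgroup : subgroup covB_set.
Proof.
split=> [|x y Bx By].
  by change ((0 : circle R) = chi 0 - circle_exp 0); rewrite (raddf0 chi) (raddf0 (@circle_exp R)) subr0.
change ((x.2 : circle R) - y.2 = chi (x.1.1 - y.1.1) - circle_exp (x.1.2 - y.1.2)).
rewrite Bx By (raddfB chi) (raddfB (@circle_exp R)) !opprB.
by rewrite [circle_exp _ - chi _]addrC addrACA [- circle_exp _ + _]addrC.
Qed.

Definition covB := subg covB_subgroup.
Definition covX := disc R.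

Lemma covB_mk_subproof (x : G) (r : R) : covB_set ((x, r), chi x - circle_exp r).
Proof. by []. Qed.

Definition covB_mk (x : G) (r : R) : covB :=
  @mksubg D covB_set covB_subgroup _ (covB_mk_subproof x r).

Lemma covB_eq (z w : covB) :
  (val z).1.1 = (val w).1.1 -> (val z).1.2 = (val w).1.2 -> z = w.
Proof.
move=> e1 e2; apply: val_inj.
rewrite [LHS]surjective_pairing [RHS]surjective_pairing; apply/pair_equal_spec; split.
  by rewrite [LHS]surjective_pairing [RHS]surjective_pairing e1 e2.
have -> : (val z).2 = chi (val z).1.1 - circle_exp (val z).1.2 := subgP z.
have -> : (val w).2 = chi (val w).1.1 - circle_exp (val w).1.2 := subgP w.
by rewrite e1 e2.
Qed.

Definition covB_phi (r : covX) : covB := covB_mk 0 r.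
Definition covB_psi (z : covB) : G := (val z).1.1.
Definition covB_real (z : covB) : R := (val z).1.2.

Lemma covB_phi_zmod_morphism : zmod_morphism covB_phi.
Proof.
move=> x y; apply: covB_eq; rewrite [in RHS]raddfB //=.
by rewrite subr0.
Qed.

Lemma covB_psi_zmod_morphism : zmod_morphism covB_psi.
Proof. by move=> x y; rewrite /covB_psi raddfB. Qed.

Lemma covB_real_zmod_morphism : zmod_morphism covB_real.
Proof. by move=> x y; rewrite /covB_real raddfB. Qed.

Let cv : continuous (val : covB -> D).
Proof. exact: subg_val_continuous. Qed.

Lemma covB_psi_continuous : continuous covB_psi.
Proof. exact: (cont_comp (@cont_fst G R) (cont_comp (@cont_fst L (disc (circle R))) cv)). Qed.

Lemma covB_real_continuous : continuous covB_real.
Proof. exact: (cont_comp (@cont_snd G R) (cont_comp (@cont_fst L (disc (circle R))) cv)). Qed.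

Lemma covB_snd_continuous : continuous (fun z : covB => (val z).2).
Proof. exact: (cont_comp (@cont_snd L (disc (circle R))) cv). Qed.

HB.instance Definition _ :=
  GRing.isZmodMorphism.Build covX covB covB_phi covB_phi_zmod_morphism.
HB.instance Definition _ :=
  @isContinuous.Build covX covB covB_phi (@continuous_disc _ _ _).
HB.instance Definition _ :=
  GRing.isZmodMorphism.Build covB G covB_psi covB_psi_zmod_morphism.
HB.instance Definition _ :=
  @isContinuous.Build covB G covB_psi covB_psi_continuous.
HB.instance Definition _ :=
  GRing.isZmodMorphism.Build covB R covB_real covB_real_zmod_morphism.

Lemma subgroup_ker_chi : subgroup [set x | chi x = 0].
Proof.
split=> [|x y /= x0 y0]; first exact: raddf0.
by change (chi (x - y) = 0); rewrite chi_zmod_morphism x0 y0 subrr.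
Qed.

(** Although [chi] need not be continuous into the discrete circle, the coordinates of chi x -
    circle_exp r are continuous real functions, and so are those of the discrete circle. The graph
    is the zero set of their differences. *)
Lemma closed_covB_set : closed covB_set.
Proof.
pose f1 (z : D) : R := (val (z.2 : circle R)).1 + - (c z.1.1 * cos z.1.2 + s z.1.1 * sin z.1.2).
pose f2 (z : D) : R := (val (z.2 : circle R)).2 + - (s z.1.1 * cos z.1.2 + - (c z.1.1 * sin z.1.2)).
have c11 : continuous (fun z : D => z.1.1).
  exact: (cont_comp (@cont_fst G R) (@cont_fst L (disc (circle R)))).
have c12 : continuous (fun z : D => z.1.2).
  exact: (cont_comp (@cont_snd G R) (@cont_fst L (disc (circle R)))).
have c21 : continuous (fun z : D => (val (z.2 : circle R)).1).
  apply: (@cont_comp _ (disc (circle R)) R (fun t => (val (t : circle R)).1)); first exact: continuous_disc.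
  exact: cont_snd.
have c22 : continuous (fun z : D => (val (z.2 : circle R)).2).
  apply: (@cont_comp _ (disc (circle R)) R (fun t => (val (t : circle R)).2)); first exact: continuous_disc.
  exact: cont_snd.
have ccos : continuous (fun z : D => cos z.1.2) := cont_comp (@continuous_cos R) c12.
have csin : continuous (fun z : D => sin z.1.2) := cont_comp (@continuous_sin R) c12.
have cc1 : continuous (fun z : D => c z.1.1) := cont_comp cc c11.
have cs1 : continuous (fun z : D => s z.1.1) := cont_comp cs c11.
have cf1 : continuous f1 by apply: contD => //; apply: contN; apply: contD; apply: contM.
have cf2 : continuous f2.
  by apply: contD => //; apply: contN; apply: contD; [|apply: contN]; apply: contM.
have cl0 : closed [set (0 : R)] by exact/accessible_closed_set1/hausdorff_accessible/Rhausdorff.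
have -> : covB_set = f1 @^-1` [set 0] `&` f2 @^-1` [set 0].
  apply/seteqP; split=> [z zB|z [/eqP]]; rewrite /f1 /f2 /=.
    by rewrite /covB_set /= in zB; rewrite zB /=; split; ring.
  rewrite subr_eq0 => /eqP e1 /eqP; rewrite subr_eq0 => /eqP e2.
  by apply: circle_eq => /=; [rewrite e1|rewrite e2]; ring.
by apply: closedI; apply: preimage_closed => // z _.
Qed.

(** Where chi x = circle_exp r the discrete coordinate is 0, so it imposes no condition. *)
Lemma nbhs_covB0 (W : set covB) : nbhs (0 : covB) W -> exists U V,
  [/\ nbhs (0 : G) U, nbhs (0 : R) V &
    forall x r, U x -> V r -> chi x = circle_exp r -> W (covB_mk x r)].
Proof.
move=> /nbhs_set_type[U' U'0 U'W].
have /nbhs_dsum0[UV [T [UV0 T0 UVT]]] : nbhs (0 : D) U' by exact: U'0.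
have [U [V [U0 V0 UVUV]]] := nbhs_dsum0 UV0.
exists U, V; split=> // x r Ux Vr e; apply: U'W.
have T1 : T (chi x - circle_exp r) by rewrite e subrr; exact: nbhs_singleton T0.
exact: (UVT (x, r) _ (UVUV _ _ Ux Vr) T1).
Qed.

(** The logarithm is asin (s x), valid near 0 where c x > 0 makes the cosine the positive root. *)
Lemma local_log (V : set R) : nbhs (0 : R) V ->
  \forall x \near (0 : G), exists2 r, V r & chi x = circle_exp r.
Proof.
move=> V0; have chi0 := congr1 val (raddf0 chi).
have c0 : c 0 = 1 by exact: (congr1 fst chi0).
have s0 : s 0 = 0 by exact: (congr1 snd chi0).
have as0 : asin (0 : R) = 0.
  rewrite -[X in asin X](sin0 R) sinK// in_itv /=.
  by have := pi_ge0 R => ?; apply/andP; split; lra.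
have N1 : \forall x \near (0 : G), V (asin (s x)).
  have ca : {for s 0, continuous (@asin R)}.
    by apply: continuous_asin; rewrite s0; apply/andP; split; lra.
  have V0' : nbhs ((asin \o s) 0) V by rewrite /= s0 as0.
  exact: (continuous_comp (cs (x := 0)) ca) V0'.
have N2 : \forall x \near (0 : G), 0 < c x.
  have /cvgrPdist_lt/(_ 1 ltr01) := cc (x := 0).
  by apply: filterS => x; rewrite c0 ltr_norml => /andP[]; lra.
apply: filterS2 N1 N2 => x Vx cx; exists (asin (s x)) => //.
have c2 : 0 < c x ^+ 2 by rewrite exprn_gt0.
have c1x := chi1 x.
have s1 : -1 <= s x <= 1.
  rewrite -ler_norml -[leRHS]ger0_norm// -ler_sqr ?nnegrE// !real_normK ?num_real//.
  rewrite expr1n; lra.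
apply: circle_eq => /=.
  rewrite cos_asin// (_ : 1 - s x ^+ 2 = c x ^+ 2); last by lra.
  by rewrite sqrtr_sqr ger0_norm// ltW.
by rewrite asinK.
Qed.

(** The kernel is discrete by [circle_exp_eq0]; openness of [covB_psi] at 0 comes from lifting x to
    (x, r) with r the small logarithm of chi x. *)
Lemma covB_extension :
  extension (covB_phi : contAdditive covX covB) (covB_psi : contAdditive covB G).
Proof.
split; split.
- exact: LCA_disc.
- apply: LCA_subg; first exact: closed_covB_set.
  apply: LCA_dsum; last exact: LCA_disc.
  by apply: LCA_dsum; [exact: LCA_compact|exact: LCA_real].
- exact: LCA_compact.
- split.
  + by move=> x y /(congr1 covB_real).
  + apply/seteqP; split=> [_ [r _ <-]//|z z0].
    by exists (covB_real z) => //; apply: covB_eq.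
  + by apply/seteqP; split=> // x _; exists (covB_mk x 0).
- pose V : set covB := [set z | `|covB_real z| <= 1] `&` [set z | (val z).2 = 0].
  apply: (@proper_disc_hom _ _ _ V).
    apply: filterI.
      have N1 : nbhs (covB_real 0) [set r : R | `|r| <= 1].
        rewrite raddf0; have /cvgrPdist_le/(_ 1 ltr01) : (fun y : R => y) @ (0 : R) --> (0 : R) by exact: cvg_id.
        by apply: filterS => y; rewrite sub0r normrN.
      exact: covB_real_continuous N1.
    have N2 : nbhs ((val (0 : covB)).2 : disc (circle R)) [set 0] by exact: nbhs_disc.
    exact: covB_snd_continuous N2.
  move=> r [/= r1 r0]; apply: circle_exp_eq0 r1 _.
  have : chi 0 - circle_exp r = 0 by exact: r0.
  by rewrite raddf0 sub0r => /eqP; rewrite oppr_eq0 => /eqP.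
- apply: proper_open_hom => W /nbhs_covB0[U [V [U0 V0 UVW]]].
  apply: filterS2 U0 (local_log V0) => x Ux [r Vr e].
  by exists (covB_mk x r) => //; exact: UVW.
Qed.

(** Real coordinates can always be divided by n, and the circle coordinate is determined by the
    other two, so only the coordinate in [G] matters. *)
Lemma ulm1_covB z : ulm1 covB z <-> ulm1 G (covB_psi z).
Proof.
split=> [uz|ux] n n0.
  by have [w _ <-] := uz n n0; exists (covB_psi w) => //; rewrite raddfMn.
have [y _ yx] := ux n n0; exists (covB_mk y (covB_real z / n%:R)) => //.
apply: covB_eq; first by rewrite -/(covB_psi _) raddfMn.
rewrite -/(covB_real _) raddfMn; change (covB_real z / n%:R *+ n = covB_real z).
by rewrite -mulr_natr divfK// pnatr_eq0 -lt0n.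
Qed.

Lemma covB_tfu :
  tfu_extension (covB_phi : contAdditive covX covB) (covB_psi : contAdditive covB G).
Proof.
have clD : closure (ulm1 G) `<=` ulm1 G by exact: closed_ulm1.
have ext := covB_extension; have [_ [[_ kerE _] _ _]] := ext.
apply: tfu_extensionI => //.
- move=> z _ z0; have [r _ rz] : range covB_phi z by rewrite kerE.
  exists r => //; apply: subset_closure => n n0; exists (r / n%:R : R) => //.
  by rewrite -[LHS]mulr_natr divfK// pnatr_eq0 -lt0n.
- move=> x /clD ux; exists (covB_mk x 0) => //.
  exact/subset_closure/ulm1_covB.
- move=> W /nbhs_covB0[U [V [U0 V0 UVW]]].
  exists (U `&` [set x | exists2 r, V r & chi x = circle_exp r]).
    exact: filterI U0 (local_log V0).
  move=> x [Ux [r Vr e]] /clD ux; exists (covB_mk x r); split=> //; first exact: UVW.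
  exact/subset_closure/ulm1_covB.
Qed.

(* The real coordinate of a section is a continuous homomorphism from a compact
   group to R, hence zero, so chi becomes continuous into the discrete circle. *)
Lemma covB_split :
  splits (covB_phi : contAdditive covX covB) (covB_psi : contAdditive covB G) ->
  open [set x | chi x = 0].
Proof.
move=> /splits_section[t [ct tK]].
have [M M0 HM] := continuous_bounded cG (cont_comp covB_real_continuous ct).
have r0 x : covB_real (t x) = 0.
  apply/eqP; rewrite -normr_le0 leNgt; apply/negP => rx.
  (* A nonzero value would have multiples exceeding the bound [M], and these are values at multiples
     of x. *)
  have := truncnS_gt (M / `|covB_real (t x)|); rewrite ltr_pdivrMr// mulr_natl ltNge => /negP; apply.
  by have := HM (x *+ (Num.truncn (M / `|covB_real (t x)|)).+1); rewrite !raddfMn normrMn.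
have tchi x : (val (t x)).2 = chi x.
  have := subgP (t x); rewrite /covB_set /= -/(covB_real _) -/(covB_psi _) r0 raddf0 subr0.
  by move=> ->; congr chi; exact: tK.
apply: (@open_comp G (disc (circle R)) chi [set 0]); last exact: open_disc.
move=> x _; rewrite (_ : chi = fun x => (val (t x)).2); last by apply/funext => y; rewrite tchi.
exact: (cont_comp covB_snd_continuous ct).
Qed.

End Cover.

(** Over the zero group [phi] is bijective, and properness makes its inverse continuous. *)
Lemma trivial_splits (A B C : topologicalZmodType)
    (phi : contAdditive A B) (psi : contAdditive B C) :
  [set: C] = [set 0] -> extension phi psi -> splits phi psi.
Proof.
move=> C0 [_ [[iphi rphi _] pphi _]].
have c0 (c : C) : c = 0 by have : [set: C] c by []; rewrite C0.
have sphi b : exists a, phi a = b.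
  have [a _ ab] : range phi b by rewrite rphi /=; exact: c0.
  by exists a.
have [f fK] := boolp.choice sphi.
have Kf : cancel phi f by move=> a; apply: iphi; rewrite fK.
have fB : zmod_morphism f.
  move=> x y; apply: iphi; rewrite fK [RHS]raddfB.
  by congr (_ - _); apply: esym; exact: fK.
have cf : continuous f.
  apply/continuousP => U /pphi[V oV UV].
  rewrite (_ : f @^-1` U = V)//; apply/seteqP; split=> b.
    by move=> Ub; have : (phi @` U) b by [exists (f b)]; rewrite UV => -[].
  move=> Vb; have : (phi @` U) b by rewrite UV; split=> //; exists (f b).
  by move=> [a Ua ab] /=; rewrite -ab Kf.
pose beta (b : B) : dsum A C := (f b, 0).
have betaB : zmod_morphism beta.
  by move=> x y; apply/pair_equal_spec; rewrite /= fB subr0.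
have betac : continuous beta.
  by move=> x; apply: cvg_pair; [exact: cf|exact: cvg_cst].
pose gamma (z : dsum A C) : B := phi z.1.
have gammaB : zmod_morphism gamma by move=> x y; rewrite /gamma raddfB.
have gammac : continuous gamma.
  move=> x; apply: (@continuous_comp _ _ _ (fun z : dsum A C => z.1) phi).
    exact: cvg_fst.
  exact: cts_fun.
pose b1 := GRing.isZmodMorphism.Build B (dsum A C) beta betaB.
pose b2 := @isContinuous.Build B (dsum A C) beta betac.
pose g1 := GRing.isZmodMorphism.Build (dsum A C) B gamma gammaB.
pose g2 := @isContinuous.Build (dsum A C) B gamma gammac.
exists (HB.pack_for (contAdditive B (dsum A C)) beta b1 b2).
exists (HB.pack_for (contAdditive (dsum A C) B) gamma g1 g2).
split=> [b|z|a|b].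
- exact: fK.
- by rewrite [RHS]surjective_pairing; apply/pair_equal_spec; split; [exact: Kf|rewrite [RHS]c0].
- by apply/pair_equal_spec; split=> //; exact: Kf.
- by rewrite [RHS]c0.
Qed.

Theorem lemma3p6 (G : topologicalZmodType) (G_hausdorff : hausdorff_space G)
    (G_compact : compact [set: G]) (G_torsion_free : torsion_free G) :
  (forall X : topologicalZmodType, LCA X -> Ext_tfu_eq0 G X) <->
  [set: G] = [set 0].
Proof.
split=> [ext0|G0 X LX B phi psi [ext _]]; last exact: trivial_splits.
apply: contrapT => Gn0; have [x1 x10] : exists x1 : G, x1 != 0.
  apply: contrapT => H; apply: Gn0; apply/seteqP; split=> x // _ /=.
  by apply/eqP; apply: contrapT => /negP xn0; apply: H; exists x.
(* The character and the cover need a model of the real numbers, which the statement does not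
   provide. *)
pose R : realType := Rdefinitions.R.
have [c [s [[cc cs] chiD chi1 [x nx]]]] := @nontrivial_character R G G_compact x1 G_hausdorff x10.
pose H := [set y | chi chi1 y = 0].
have sH : subgroup H := subgroup_ker_chi chiD chi1.
have oH : open H.
  apply: (covB_split G_compact (chiD := chiD)).
  apply: ext0; first exact: LCA_disc.
  exact: covB_tfu.
have HT : H = setT.
  apply: (openB_split G_compact G_torsion_free (sH := sH)).
  apply: ext0; first exact: LCA_disc.
  exact: openB_tfu.
have Hx : H x by rewrite HT.
apply: nx; split; [exact: (congr1 (fun z => (val z).1) Hx)|].
exact: (congr1 (fun z => (val z).2) Hx).
Qed.
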